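(* Let $P \blacktriangleright \Delta; \mathcal{C}$, and assume $\mathsf{undef}_{\sim}(\mathcal C)=\emptyset$. If 1. $\mathcal{C} \Vdash T \mathrel{\hat\sim} S$ where $T$ and $S$ are proper type expressions implies that $T$ and $S$ have the same topmost constructor, and 2. $\sigma_{use}$ is a solution of the use constraints of $\overline{\mathcal{C}}$, and 3. $\sigma_{type}$ is the solution of the system of equations $\Sigma := \{ \alpha = \sigma_{use}\, \mathsf{crep}_{=}(\overline{\mathcal{C}}, \alpha) \mid \alpha \in \mathsf{expr}(\overline{\mathcal{C}}) \}$, then $\sigma_{use} \cup \sigma_{type}$ is a solution for $\mathcal{C}$.
   Context: **Language.** Fix a countable set of channels $a,b,c,\dots$ and a disjoint countable set of variables $x,y,\dots$; names $u$ are channels or variables. Expressions: $e,f ::= n$ (integer constants) $\mid u \mid (e,f) \mid \mathsf{fst}(e) \mid \mathsf{snd}(e) \mid \mathsf{inl}(e) \mid \mathsf{inr}(e)$. Processes: $P,Q ::= \mathsf{idle} \mid e?(x).P \mid e!f \mid P\,|\,Q \mid {*}P \mid \mathsf{new}\ a\ \mathsf{in}\ P \mid \mathsf{case}\ e\ \{i(x_i)\Rightarrow P_i\}_{i=\mathsf{inl},\mathsf{inr}}$, identified modulo renaming of bound names (input binds $x$, $\mathsf{new}$ binds $a$, $\mathsf{case}$ binds $x_i$ in $P_i$). **Types.** Uses $\kappa\in\{0,1,\omega\}$, with $\kappa+0=0+\kappa=\kappa$ and $\kappa_1+\kappa_2=\omega$ if both are nonzero. Types $t,s$ are the possibly infinite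 regular trees built from the nullary constructor $\mathsf{int}$, unary constructors $[\cdot]^{\kappa_1,\kappa_2}$ (channel types), binary $\times$ and $\oplus$; type equality is equality of trees; $\odot$ stands for $\times$ or $\oplus$. Type combination $+$ is the partial binary function on types whose graph is the largest relation $\mathcal R$ such that $((t_1,t_2),s)\in\mathcal R$ implies: either $t_1=t_2=s=\mathsf{int}$; or $t_1=[t]^{\kappa_1,\kappa_2}$, $t_2=[t]^{\kappa_3,\kappa_4}$, $s=[t]^{\kappa_1+\kappa_3,\kappa_2+\kappa_4}$; or $t_1=t_{11}\odot t_{12}$, $t_2=t_{21}\odot t_{22}$, $s=s_1\odot s_2$ with $((t_{1i},t_{2i}),s_i)\in\mathcal R$ for $i=1,2$ (same $\odot$ throughout). $t\sim s$ (coherent) means $t+s$ is defined. **Type expressions and constraints.** Fix countable sets of type variables $\alpha,\beta,\dots$ and use variables $\varrho,\dots$. Use expressions: $U,V::=\varrho\mid\kappa\mid U+V$ (with $2U:=U+U$). Type expressions (finite terms): $T,S::=\alpha\mid\mathsf{int}\mid[T]^{U,V}\mid T\times S\mid T\oplus S$. $T$ is proper if it is not a type variable; its topmost constructor is then one of $\mathsf{int}$, channel $[\cdot]$ (regardless of the uses), $\times$, $\oplus$. Constraints: $T\mathrel{\hat=}S$, $T\mathrel{\hat=}S_1+S_2$, $T\mathrel{\hat\sim}S$, $U\mathrel{\hat=}V$. $\mathsf{un}(T)$ abbreviates $T\mathrel{\hat=}T+T$. $\mathcal C$ ranges over finite constraint sets; $\mathsf{expr}(\mathcal C)$ is the set of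 use and type expressions occurring (also as subexpressions) in the constraints of $\mathcal C$. Environments $\Delta$ are finite maps from names to type expressions; $\Delta_1,\Delta_2$ is union with disjoint domains. **Substitutions and solutions.** A substitution $\sigma$ is a finite map from type variables to types and from use variables to uses; $\sigma T$, $\sigma U$ denote its application (computing use combinations). $\sigma$ is a solution for $\mathcal C$ if its domain contains all type and use variables in $\mathsf{expr}(\mathcal C)$ and: $T\mathrel{\hat=}S\in\mathcal C$ implies $\sigma T=\sigma S$; $T\mathrel{\hat=}S_1+S_2\in\mathcal C$ implies $\sigma T=\sigma S_1+\sigma S_2$; $T\mathrel{\hat\sim}S\in\mathcal C$ implies $\sigma T\sim\sigma S$; $U\mathrel{\hat=}V\in\mathcal C$ implies $\sigma U=\sigma V$. **Environment operators.** $\Delta_1\sqcup\Delta_2\leadsto\Delta;\mathcal C$: if $\mathrm{dom}(\Delta_1)\cap\mathrm{dom}(\Delta_2)=\emptyset$ then $\Delta_1\sqcup\Delta_2\leadsto(\Delta_1,\Delta_2);\emptyset$; if $\Delta_1\sqcup\Delta_2\leadsto\Delta;\mathcal C$ and $\alpha$ is fresh then $(\Delta_1,u:T)\sqcup(\Delta_2,u:S)\leadsto(\Delta,u:\alpha);\mathcal C\cup\{\alpha\mathrel{\hat=}T+S\}$. $\Delta_1\sqcap\Delta_2\leadsto\Delta;\mathcal C$: $\emptyset\sqcap\emptyset\leadsto\emptyset;\emptyset$; if $\Delta_1\sqcap\Delta_2\leadsto\Delta;\mathcal C$ then $(\Delta_1,u:T)\sqcap(\Delta_2,u:S)\leadsto(\Delta,u:T);\mathcal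 C\cup\{T\mathrel{\hat=}S\}$. **Constraint generation** (all type/use variables introduced by a rule are fresh). Expressions, $e:T\blacktriangleright\Delta;\mathcal C$: $n:\mathsf{int}\blacktriangleright\emptyset;\emptyset$; $u:\alpha\blacktriangleright u:\alpha;\emptyset$; if $e:T\blacktriangleright\Delta;\mathcal C$ then $\mathsf{inl}(e):T\oplus\alpha\blacktriangleright\Delta;\mathcal C$, $\mathsf{inr}(e):\alpha\oplus T\blacktriangleright\Delta;\mathcal C$, $\mathsf{fst}(e):\alpha\blacktriangleright\Delta;\mathcal C\cup\{T\mathrel{\hat=}\alpha\times\beta,\mathsf{un}(\beta)\}$, $\mathsf{snd}(e):\beta\blacktriangleright\Delta;\mathcal C\cup\{T\mathrel{\hat=}\alpha\times\beta,\mathsf{un}(\alpha)\}$; if $e_i:T_i\blacktriangleright\Delta_i;\mathcal C_i$ ($i=1,2$) and $\Delta_1\sqcup\Delta_2\leadsto\Delta;\mathcal C_3$ then $(e_1,e_2):T_1\times T_2\blacktriangleright\Delta;\mathcal C_1\cup\mathcal C_2\cup\mathcal C_3$. Processes, $P\blacktriangleright\Delta;\mathcal C$: - $\mathsf{idle}\blacktriangleright\emptyset;\emptyset$. - If $e:T\blacktriangleright\Delta_1;\mathcal C_1$, $P\blacktriangleright\Delta_2,x:S;\mathcal C_2$, $\Delta_1\sqcup\Delta_2\leadsto\Delta;\mathcal C_3$ then $e?(x).P\blacktriangleright\Delta;\mathcal C_1\cup\mathcal C_2\cup\mathcal C_3\cup\{T\mathrel{\hat=}[S]^{1+\varrho_1,2\varrho_2}\}$.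 - If $e:T\blacktriangleright\Delta_1;\mathcal C_1$, $f:S\blacktriangleright\Delta_2;\mathcal C_2$, $\Delta_1\sqcup\Delta_2\leadsto\Delta;\mathcal C_3$ then $e!f\blacktriangleright\Delta;\mathcal C_1\cup\mathcal C_2\cup\mathcal C_3\cup\{T\mathrel{\hat=}[S]^{2\varrho_1,1+\varrho_2}\}$. - If $P\blacktriangleright\Delta;\mathcal C$ and $\Delta\sqcup\Delta\leadsto\Delta';\mathcal C'$ then ${*}P\blacktriangleright\Delta';\mathcal C\cup\mathcal C'$. - If $P_i\blacktriangleright\Delta_i;\mathcal C_i$ ($i=1,2$) and $\Delta_1\sqcup\Delta_2\leadsto\Delta;\mathcal C_3$ then $P_1\,|\,P_2\blacktriangleright\Delta;\mathcal C_1\cup\mathcal C_2\cup\mathcal C_3$. - If $P\blacktriangleright\Delta,a:T;\mathcal C$ then $\mathsf{new}\ a\ \mathsf{in}\ P\blacktriangleright\Delta;\mathcal C\cup\{T\mathrel{\hat=}[\alpha]^{\varrho,\varrho}\}$. - If $e:T\blacktriangleright\Delta_1;\mathcal C_1$, $P_i\blacktriangleright\Delta_i,x_i:T_i;\mathcal C_i$ ($i=\mathsf{inl},\mathsf{inr}$), $\Delta_{\mathsf{inl}}\sqcap\Delta_{\mathsf{inr}}\leadsto\Delta_2;\mathcal C_2$, $\Delta_1\sqcup\Delta_2\leadsto\Delta;\mathcal C_3$ then $\mathsf{case}\ e\ \{i(x_i)\Rightarrow P_i\}_{i=\mathsf{inl},\mathsf{inr}}\blacktriangleright\Delta;\mathcal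 C_1\cup\mathcal C_2\cup\mathcal C_3\cup\mathcal C_{\mathsf{inl}}\cup\mathcal C_{\mathsf{inr}}\cup\{T\mathrel{\hat=}T_{\mathsf{inl}}\oplus T_{\mathsf{inr}}\}$. - (weakening) If $P\blacktriangleright\Delta;\mathcal C$ then $P\blacktriangleright\Delta,u:\alpha;\mathcal C\cup\{\mathsf{un}(\alpha)\}$. **Deduction system** $\mathcal C\Vdash\varphi$, with $\mathcal R$ ranging over $=$ and $\sim$ (so $\hat{\mathcal R}$ is $\hat=$ or $\hat\sim$): (axiom) $\mathcal C\Vdash\varphi$ if $\varphi\in\mathcal C$; (refl) $\mathcal C\Vdash T\mathrel{\hat{\mathcal R}}T$ if $T\in\mathsf{expr}(\mathcal C)$; (symm), (trans) $\hat{\mathcal R}$ between type expressions is symmetric and transitive; (coh 1) $T\mathrel{\hat=}S$ gives $T\mathrel{\hat\sim}S$; (coh 2) $T\mathrel{\hat=}S_1+S_2$ gives $T\mathrel{\hat\sim}S_i$, $i=1,2$; (cong 1) $[T]^{U_1,U_2}\mathrel{\hat\sim}[S]^{V_1,V_2}$ gives $T\mathrel{\hat=}S$; (cong 2) $T_1\odot T_2\mathrel{\hat{\mathcal R}}S_1\odot S_2$ gives $T_i\mathrel{\hat{\mathcal R}}S_i$, $i=1,2$; (cong 3) $T_1\odot T_2\mathrel{\hat=}S_1\odot S_2+S_3\odot S_4$ gives $T_i\mathrel{\hat=}S_i+S_{i+2}$, $i=1,2$; (subst) $T_1\mathrel{\hat=}T_2+T_3$ and $T_i\mathrel{\hat=}S_i$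 for $1\le i\le3$ give $S_1\mathrel{\hat=}S_2+S_3$; (use 1) $[T]^{U_1,U_2}\mathrel{\hat=}[S]^{V_1,V_2}$ gives $U_i\mathrel{\hat=}V_i$, $i=1,2$; (use 2) $[T]^{U_1,U_2}\mathrel{\hat=}[S_1]^{V_1,V_2}+[S_2]^{V_3,V_4}$ gives $U_i\mathrel{\hat=}V_i+V_{i+2}$, $i=1,2$. **Canonical representatives.** Fix a total order $\sqsubseteq$ on type expressions such that $T\sqsubseteq\alpha$ for every proper $T$ and every type variable $\alpha$. For $\mathcal R\in\{=,\sim\}$ and $T\in\mathsf{expr}(\mathcal C)$, $\mathsf{crep}_{\mathcal R}(\mathcal C,T)$ is the $\sqsubseteq$-least $S$ such that $\mathcal C\Vdash T\mathrel{\hat{\mathcal R}}S$. $\mathsf{undef}_{\mathcal R}(\mathcal C)$ is the set of type variables $\alpha\in\mathsf{expr}(\mathcal C)$ such that $\mathsf{crep}_{\mathcal R}(\mathcal C,\alpha)$ is not proper. **Completion.** Let $\mathsf t$ be an injective function mapping pairs of type variables to type variables distinct from all those introduced by constraint generation. Define $\mathsf{instance}(\alpha,\beta)=\mathsf t(\alpha,\beta)$; $\mathsf{instance}(\alpha,\mathsf{int})=\mathsf{int}$; $\mathsf{instance}(\alpha,[S]^{U,V})=[S]^{\varrho_1,\varrho_2}$ with $\varrho_1,\varrho_2$ fresh use variables (chosen by some deterministic mechanism, so that each instantiation is a fixed expression); $\mathsf{instance}(\alpha,T_1\odot T_2)=\mathsf{instance}(\alpha,T_1)\odot\mathsf{instance}(\alpha,T_2)$.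 The completion $\overline{\mathcal C}$ is the least set such that: $\mathcal C\subseteq\overline{\mathcal C}$; $\alpha\in\mathsf{undef}_{=}(\mathcal C)$ implies $\alpha\mathrel{\hat=}\mathsf t(\alpha,\alpha)\in\overline{\mathcal C}$; $\mathsf t(\alpha,\beta)\in\mathsf{expr}(\overline{\mathcal C})$ implies $\mathsf t(\alpha,\beta)\mathrel{\hat=}\mathsf{instance}(\alpha,\mathsf{crep}_{\sim}(\mathcal C,\beta))\in\overline{\mathcal C}$. **Use constraints and system.** The use constraints of $\overline{\mathcal C}$ are the constraints $U\mathrel{\hat=}V$ with $\overline{\mathcal C}\Vdash U\mathrel{\hat=}V$; a solution $\sigma_{use}$ of them is a map from all use variables in $\mathsf{expr}(\overline{\mathcal C})$ to $\{0,1,\omega\}$ with $\sigma_{use}U=\sigma_{use}V$ for each of them. Here $\sigma_{use}T$ replaces only use variables in $T$. The solution $\sigma_{type}$ of $\Sigma$ is the unique substitution of regular trees for the type variables in $\mathsf{expr}(\overline{\mathcal C})$ satisfying all equations of $\Sigma$. *)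

(* Defs.v *)
From Stdlib Require Import List.
From mathcomp Require Import all_boot ssrint finmap.
From mathcomp Require Import boolp classical_sets.

Set Implicit Arguments.
Unset Strict Implicit.
Unset Printing Implicit Defensive.

Local Open Scope fset_scope.
Local Open Scope fmap_scope.
Local Open Scope classical_set_scope.

(** * Processes *)

Definition channel := nat.
Definition variable := nat.

Definition name := (channel + variable)%type.
Definition NChan (a : channel) : name := inl a.
Definition NVar (x : variable) : name := inr x.

Inductive expr : Type :=
| ENum of int
| EName of name
| EPair of expr & expr
| EFst of expr
| ESnd of expr
| EInl of expr
| EInr of expr.

Inductive proc : Type :=
| PIdle
| PIn of expr & variable & proc
| POut of expr & expr
| PPar of proc & proc
| PRep of proc
| PNew of channel & proc
| PCase of expr & variable & proc & variable & proc.

Fixpoint efn (e : expr) : {fset name} :=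
  match e with
  | ENum _ => fset0
  | EName u => [fset u]%fset
  | EPair e1 e2 => (efn e1 `|` efn e2)%fset
  | EFst e1 | ESnd e1 | EInl e1 | EInr e1 => efn e1
  end.

Fixpoint pfn (P : proc) : {fset name} :=
  match P with
  | PIdle => fset0
  | PIn e x P1 => (efn e `|` (pfn P1 `\ NVar x))%fset
  | POut e f => (efn e `|` efn f)%fset
  | PPar P1 P2 => (pfn P1 `|` pfn P2)%fset
  | PRep P1 => pfn P1
  | PNew a P1 => (pfn P1 `\ NChan a)%fset
  | PCase e x1 P1 x2 P2 =>
      (efn e `|` ((pfn P1 `\ NVar x1) `|` (pfn P2 `\ NVar x2)))%fset
  end.

(* The renaming acts on every occurrence of a name, including binders; it is
   only used with transpositions, which makes it capture-avoiding. *)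
Definition rename_name (fc : channel -> channel) (fv : variable -> variable)
    (u : name) : name :=
  match u with inl a => NChan (fc a) | inr x => NVar (fv x) end.

Fixpoint rename_expr fc fv (e : expr) : expr :=
  match e with
  | ENum n => ENum n
  | EName u => EName (rename_name fc fv u)
  | EPair e1 e2 => EPair (rename_expr fc fv e1) (rename_expr fc fv e2)
  | EFst e1 => EFst (rename_expr fc fv e1)
  | ESnd e1 => ESnd (rename_expr fc fv e1)
  | EInl e1 => EInl (rename_expr fc fv e1)
  | EInr e1 => EInr (rename_expr fc fv e1)
  end.

Fixpoint rename_proc fc fv (P : proc) : proc :=
  match P with
  | PIdle => PIdle
  | PIn e x P1 => PIn (rename_expr fc fv e) (fv x) (rename_proc fc fv P1)
  | POut e f => POut (rename_expr fc fv e) (rename_expr fc fv f)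
  | PPar P1 P2 => PPar (rename_proc fc fv P1) (rename_proc fc fv P2)
  | PRep P1 => PRep (rename_proc fc fv P1)
  | PNew a P1 => PNew (fc a) (rename_proc fc fv P1)
  | PCase e x1 P1 x2 P2 =>
      PCase (rename_expr fc fv e) (fv x1) (rename_proc fc fv P1)
                                  (fv x2) (rename_proc fc fv P2)
  end.

Definition transpose (i j k : nat) : nat :=
  if k == i then j else if k == j then i else k.

Definition swap_var (x y : variable) : proc -> proc :=
  rename_proc id (transpose x y).
Definition swap_chan (a b : channel) : proc -> proc :=
  rename_proc (transpose a b) id.

(* Renaming of bound names: the least congruence that replaces a bound name by
   one that is not free in its scope. *)
Inductive alpha : proc -> proc -> Prop :=
| alpha_refl P : alpha P P
| alpha_sym P Q : alpha P Q -> alpha Q P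
| alpha_trans P Q R : alpha P Q -> alpha Q R -> alpha P R
| alpha_in e x P Q : alpha P Q -> alpha (PIn e x P) (PIn e x Q)
| alpha_par P P' Q Q' :
    alpha P P' -> alpha Q Q' -> alpha (PPar P Q) (PPar P' Q')
| alpha_rep P Q : alpha P Q -> alpha (PRep P) (PRep Q)
| alpha_new a P Q : alpha P Q -> alpha (PNew a P) (PNew a Q)
| alpha_case e x P P' y Q Q' :
    alpha P P' -> alpha Q Q' ->
    alpha (PCase e x P y Q) (PCase e x P' y Q')
| alpha_in_ren e x y P :
    NVar y \notin pfn P -> alpha (PIn e x P) (PIn e y (swap_var x y P))
| alpha_new_ren a b P :
    NChan b \notin pfn P -> alpha (PNew a P) (PNew b (swap_chan a b P))
| alpha_case_inl_ren e x x' P y Q :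
    NVar x' \notin pfn P ->
    alpha (PCase e x P y Q) (PCase e x' (swap_var x x' P) y Q)
| alpha_case_inr_ren e x P y y' Q :
    NVar y' \notin pfn Q ->
    alpha (PCase e x P y Q) (PCase e x P y' (swap_var y y' Q)).

(** * Types *)

Inductive use : Type := Use0 | Use1 | UseW.

Definition use_add (k1 k2 : use) : use :=
  match k1, k2 with
  | Use0, k => k
  | k, Use0 => k
  | _, _ => UseW
  end.

Inductive binop : Type := OpProd | OpSum.

CoInductive tree : Type :=
| Int
| Chan of tree & use & use
| Bin of binop & tree & tree.

(* Equality of infinite trees is bisimilarity: Leibniz equality of coinductive
   terms is too fine. *)
CoInductive teq : tree -> tree -> Prop :=
| teq_int : teq Int Int
| teq_chan t s k1 k2 : teq t s -> teq (Chan t k1 k2) (Chan s k1 k2)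
| teq_bin o t1 t2 s1 s2 :
    teq t1 s1 -> teq t2 s2 -> teq (Bin o t1 t2) (Bin o s1 s2).

Inductive subtree : tree -> tree -> Prop :=
| subtree_refl t : subtree t t
| subtree_chan r t k1 k2 : subtree r t -> subtree r (Chan t k1 k2)
| subtree_binl r o t1 t2 : subtree r t1 -> subtree r (Bin o t1 t2)
| subtree_binr r o t1 t2 : subtree r t2 -> subtree r (Bin o t1 t2).

Definition regular (t : tree) : Prop :=
  exists l : seq tree,
    forall r, subtree r t -> exists r', List.In r' l /\ teq r r'.

Record type : Type := MkType { tree_of :> tree; tree_ofP : regular tree_of }.

(* [tcomb t1 t2 s] is t1 + t2 = s. Since subtrees of regular trees are regular,
   restricting this greatest relation to regular trees gives the greatest such
   relation on types. *)
CoInductive tcomb : tree -> tree -> tree -> Prop :=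
| tcomb_int : tcomb Int Int Int
| tcomb_chan t t1 t2 k1 k2 k3 k4 :
    teq t1 t -> teq t2 t ->
    tcomb (Chan t1 k1 k2) (Chan t2 k3 k4)
          (Chan t (use_add k1 k3) (use_add k2 k4))
| tcomb_bin o t11 t12 t21 t22 s1 s2 :
    tcomb t11 t21 s1 -> tcomb t12 t22 s2 ->
    tcomb (Bin o t11 t12) (Bin o t21 t22) (Bin o s1 s2).

Definition coherent (t s : tree) : Prop := exists r : type, tcomb t s r.

(** * Type expressions and constraints *)

Definition tvar := nat.
Definition uvar := nat.

Inductive uexpr : Type :=
| UVar of uvar
| UConst of use
| UAdd of uexpr & uexpr.

Definition udouble (U : uexpr) : uexpr := UAdd U U.

Inductive texpr : Type :=
| TVar of tvar
| TInt
| TChan of texpr & uexpr & uexpr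
| TBin of binop & texpr & texpr.

Inductive con : Type := ConInt | ConChan | ConBin of binop.

Definition topcon (T : texpr) : option con :=
  match T with
  | TVar _ => None
  | TInt => Some ConInt
  | TChan _ _ _ => Some ConChan
  | TBin o _ _ => Some (ConBin o)
  end.

Definition tproper (T : texpr) : Prop := forall a, T <> TVar a.

Inductive constr : Type :=
| CEq of texpr & texpr
| CComb of texpr & texpr & texpr
| CCoh of texpr & texpr
| CUse of uexpr & uexpr.

Definition un (T : texpr) : constr := CComb T T T.

Fixpoint uexpr_in_uexpr (V U : uexpr) : Prop :=
  V = U \/
  match U with
  | UAdd U1 U2 => uexpr_in_uexpr V U1 \/ uexpr_in_uexpr V U2
  | _ => False
  end.

Fixpoint texpr_in_texpr (S T : texpr) : Prop :=
  S = T \/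
  match T with
  | TChan T1 _ _ => texpr_in_texpr S T1
  | TBin _ T1 T2 => texpr_in_texpr S T1 \/ texpr_in_texpr S T2
  | _ => False
  end.

Fixpoint uexpr_in_texpr (V : uexpr) (T : texpr) : Prop :=
  match T with
  | TChan T1 U1 U2 =>
      [\/ uexpr_in_texpr V T1, uexpr_in_uexpr V U1 | uexpr_in_uexpr V U2]
  | TBin _ T1 T2 => uexpr_in_texpr V T1 \/ uexpr_in_texpr V T2
  | _ => False
  end.

Definition texpr_in_constr (R : texpr) (phi : constr) : Prop :=
  match phi with
  | CEq T1 T2 | CCoh T1 T2 => texpr_in_texpr R T1 \/ texpr_in_texpr R T2
  | CComb T1 T2 T3 =>
      [\/ texpr_in_texpr R T1, texpr_in_texpr R T2 | texpr_in_texpr R T3]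
  | CUse _ _ => False
  end.

Definition uexpr_in_constr (W : uexpr) (phi : constr) : Prop :=
  match phi with
  | CEq T1 T2 | CCoh T1 T2 => uexpr_in_texpr W T1 \/ uexpr_in_texpr W T2
  | CComb T1 T2 T3 =>
      [\/ uexpr_in_texpr W T1, uexpr_in_texpr W T2 | uexpr_in_texpr W T3]
  | CUse U V => uexpr_in_uexpr W U \/ uexpr_in_uexpr W V
  end.

(* expr(C), split into its type expressions and its use expressions. *)
Definition texprs (C : set constr) : set texpr :=
  [set T | exists phi, C phi /\ texpr_in_constr T phi].
Definition uexprs (C : set constr) : set uexpr :=
  [set U | exists phi, C phi /\ uexpr_in_constr U phi].

(** * Substitutions and solutions *)

Definition usubst := {fmap uvar -> use}.
Definition tsubst := {fmap tvar -> type}.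

(* Type and use variables being of different sorts, the union of a type
   substitution and a use substitution is a pair. *)
Record subst : Type := Subst { subst_type : tsubst; subst_use : usubst }.

(* Application is undefined ([None]) outside the domain. *)
Fixpoint apply_use (s : usubst) (U : uexpr) : option use :=
  match U with
  | UVar r => s.[? r]
  | UConst k => Some k
  | UAdd U1 U2 =>
      if (apply_use s U1, apply_use s U2) is (Some k1, Some k2)
      then Some (use_add k1 k2) else None
  end.

Fixpoint apply (s : subst) (T : texpr) : option tree :=
  match T with
  | TVar a => omap tree_of (subst_type s).[? a]
  | TInt => Some Int
  | TChan T1 U1 U2 =>
      if (apply s T1, apply_use (subst_use s) U1, apply_use (subst_use s) U2)
         is (Some t, Some k1, Some k2)
      then Some (Chan t k1 k2) else None
  | TBin o T1 T2 =>
      if (apply s T1, apply s T2) is (Some t1, Some t2)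
      then Some (Bin o t1 t2) else None
  end.

Definition satisfies (s : subst) (phi : constr) : Prop :=
  match phi with
  | CEq T1 T2 => exists t1 t2,
      [/\ apply s T1 = Some t1, apply s T2 = Some t2 & teq t1 t2]
  | CComb T T1 T2 => exists t t1 t2,
      [/\ apply s T = Some t, apply s T1 = Some t1, apply s T2 = Some t2
        & tcomb t1 t2 t]
  | CCoh T1 T2 => exists t1 t2,
      [/\ apply s T1 = Some t1, apply s T2 = Some t2 & coherent t1 t2]
  | CUse U V => exists k, apply_use (subst_use s) U = Some k /\
                          apply_use (subst_use s) V = Some k
  end.

Definition solution (s : subst) (C : set constr) : Prop :=
  [/\ forall a, texprs C (TVar a) -> a \in domf (subst_type s),
      forall r, uexprs C (UVar r) -> r \in domf (subst_use s)
    & forall phi, C phi -> satisfies s phi].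

(** * Constraint generation *)

Definition env := {fmap name -> texpr}.

(* The judgments below carry the finite set of the type and use variables
   introduced by their derivation. A variable is fresh when it is not in the
   sets of the premises, and distinct premises have disjoint sets.
   [D1.[u <- T]] with [u \notin domf D1] encodes the environment D1, u : T. *)
Definition var := (tvar + uvar)%type.
Definition VT (a : tvar) : var := inl a.
Definition VU (r : uvar) : var := inr r.

Definition fresh (vs : seq var) (X : {fset var}) : Prop :=
  uniq vs /\ forall v, v \in vs -> v \notin X.

Definition add_vars (vs : seq var) (X : {fset var}) : {fset var} :=
  ([fset v in vs] `|` X)%fset.

Definition pairwise_disjoint (Xs : seq {fset var}) : bool :=
  pairwise (fun X Y => [disjoint X & Y])%fset Xs.

(* Freshness of the variables of [merge] with respect to the merged
   environments is ensured where it is used, by disjointness of its set of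
   introduced variables from those of the other premises. *)
Inductive merge : env -> env -> env -> set constr -> {fset var} -> Prop :=
| merge_disjoint D1 D2 :
    [disjoint domf D1 & domf D2]%fset ->
    merge D1 D2 (D1 + D2)%fmap set0 fset0
| merge_common D1 D2 D C X u T S a :
    merge D1 D2 D C X ->
    u \notin domf D1 -> u \notin domf D2 ->
    fresh [:: VT a] X ->
    merge D1.[u <- T] D2.[u <- S] D.[u <- TVar a]
          (C `|` [set CComb (TVar a) T S]) (add_vars [:: VT a] X).

Inductive unify : env -> env -> env -> set constr -> Prop :=
| unify_empty : unify [fmap] [fmap] [fmap] set0
| unify_common D1 D2 D C u T S :
    unify D1 D2 D C ->
    u \notin domf D1 -> u \notin domf D2 ->
    unify D1.[u <- T] D2.[u <- S] D.[u <- T] (C `|` [set CEq T S]).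

Inductive egen :
  expr -> texpr -> env -> set constr -> {fset var} -> Prop :=
| egen_num n : egen (ENum n) TInt [fmap] set0 fset0
| egen_name u a :
    egen (EName u) (TVar a) [fmap].[u <- TVar a] set0 (add_vars [:: VT a] fset0)
| egen_inl e T D C X a :
    egen e T D C X -> fresh [:: VT a] X ->
    egen (EInl e) (TBin OpSum T (TVar a)) D C (add_vars [:: VT a] X)
| egen_inr e T D C X a :
    egen e T D C X -> fresh [:: VT a] X ->
    egen (EInr e) (TBin OpSum (TVar a) T) D C (add_vars [:: VT a] X)
| egen_fst e T D C X a b :
    egen e T D C X -> fresh [:: VT a; VT b] X ->
    egen (EFst e) (TVar a) D
      (C `|` [set CEq T (TBin OpProd (TVar a) (TVar b)); un (TVar b)])
      (add_vars [:: VT a; VT b] X)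
| egen_snd e T D C X a b :
    egen e T D C X -> fresh [:: VT a; VT b] X ->
    egen (ESnd e) (TVar b) D
      (C `|` [set CEq T (TBin OpProd (TVar a) (TVar b)); un (TVar a)])
      (add_vars [:: VT a; VT b] X)
| egen_pair e1 e2 T1 T2 D1 D2 D C1 C2 C3 X1 X2 X3 :
    egen e1 T1 D1 C1 X1 -> egen e2 T2 D2 C2 X2 ->
    merge D1 D2 D C3 X3 ->
    pairwise_disjoint [:: X1; X2; X3] ->
    egen (EPair e1 e2) (TBin OpProd T1 T2) D (C1 `|` C2 `|` C3)
         (X1 `|` X2 `|` X3)%fset.

Inductive pgen : proc -> env -> set constr -> {fset var} -> Prop :=
| pgen_idle : pgen PIdle [fmap] set0 fset0
| pgen_in e x P T S D1 D2 D C1 C2 C3 X1 X2 X3 r1 r2 :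
    egen e T D1 C1 X1 ->
    NVar x \notin domf D2 -> pgen P D2.[NVar x <- S] C2 X2 ->
    merge D1 D2 D C3 X3 ->
    pairwise_disjoint [:: X1; X2; X3] ->
    fresh [:: VU r1; VU r2] (X1 `|` X2 `|` X3)%fset ->
    pgen (PIn e x P) D
      (C1 `|` C2 `|` C3 `|`
       [set CEq T (TChan S (UAdd (UConst Use1) (UVar r1)) (udouble (UVar r2)))])
      (add_vars [:: VU r1; VU r2] (X1 `|` X2 `|` X3)%fset)
| pgen_out e f T S D1 D2 D C1 C2 C3 X1 X2 X3 r1 r2 :
    egen e T D1 C1 X1 -> egen f S D2 C2 X2 ->
    merge D1 D2 D C3 X3 ->
    pairwise_disjoint [:: X1; X2; X3] ->
    fresh [:: VU r1; VU r2] (X1 `|` X2 `|` X3)%fset ->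
    pgen (POut e f) D
      (C1 `|` C2 `|` C3 `|`
       [set CEq T (TChan S (udouble (UVar r1)) (UAdd (UConst Use1) (UVar r2)))])
      (add_vars [:: VU r1; VU r2] (X1 `|` X2 `|` X3)%fset)
| pgen_rep P D D' C C' X X' :
    pgen P D C X -> merge D D D' C' X' ->
    pairwise_disjoint [:: X; X'] ->
    pgen (PRep P) D' (C `|` C') (X `|` X')%fset
| pgen_par P1 P2 D1 D2 D C1 C2 C3 X1 X2 X3 :
    pgen P1 D1 C1 X1 -> pgen P2 D2 C2 X2 ->
    merge D1 D2 D C3 X3 ->
    pairwise_disjoint [:: X1; X2; X3] ->
    pgen (PPar P1 P2) D (C1 `|` C2 `|` C3) (X1 `|` X2 `|` X3)%fset
| pgen_new a P T D C X b r :
    NChan a \notin domf D -> pgen P D.[NChan a <- T] C X ->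
    fresh [:: VT b; VU r] X ->
    pgen (PNew a P) D (C `|` [set CEq T (TChan (TVar b) (UVar r) (UVar r))])
         (add_vars [:: VT b; VU r] X)
| pgen_case e xl Pl xr Pr T Tl Tr D1 Dl Dr D2 D C1 Cl Cr C2 C3 X1 Xl Xr X3 :
    egen e T D1 C1 X1 ->
    NVar xl \notin domf Dl -> pgen Pl Dl.[NVar xl <- Tl] Cl Xl ->
    NVar xr \notin domf Dr -> pgen Pr Dr.[NVar xr <- Tr] Cr Xr ->
    unify Dl Dr D2 C2 ->
    merge D1 D2 D C3 X3 ->
    pairwise_disjoint [:: X1; Xl; Xr; X3] ->
    pgen (PCase e xl Pl xr Pr) D
      (C1 `|` C2 `|` C3 `|` Cl `|` Cr `|` [set CEq T (TBin OpSum Tl Tr)])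
      (X1 `|` Xl `|` Xr `|` X3)%fset
| pgen_weak P D C X u a :
    pgen P D C X -> u \notin domf D -> fresh [:: VT a] X ->
    pgen P D.[u <- TVar a] (C `|` [set un (TVar a)]) (add_vars [:: VT a] X)
| pgen_alpha P Q D C X : alpha P Q -> pgen P D C X -> pgen Q D C X.

(** * Deduction system *)

Inductive trel : Type := REq | RCoh.

Definition crel (R : trel) : texpr -> texpr -> constr :=
  match R with REq => CEq | RCoh => CCoh end.

Inductive deduce (C : set constr) : constr -> Prop :=
| d_axiom phi : C phi -> deduce C phi
| d_refl R T : texprs C T -> deduce C (crel R T T)
| d_symm R T S : deduce C (crel R T S) -> deduce C (crel R S T)
| d_trans R T1 T2 T3 :
    deduce C (crel R T1 T2) -> deduce C (crel R T2 T3) ->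
    deduce C (crel R T1 T3)
| d_coh1 T S : deduce C (CEq T S) -> deduce C (CCoh T S)
| d_coh2_l T S1 S2 : deduce C (CComb T S1 S2) -> deduce C (CCoh T S1)
| d_coh2_r T S1 S2 : deduce C (CComb T S1 S2) -> deduce C (CCoh T S2)
| d_cong1 T S U1 U2 V1 V2 :
    deduce C (CCoh (TChan T U1 U2) (TChan S V1 V2)) -> deduce C (CEq T S)
| d_cong2_l R o T1 T2 S1 S2 :
    deduce C (crel R (TBin o T1 T2) (TBin o S1 S2)) -> deduce C (crel R T1 S1)
| d_cong2_r R o T1 T2 S1 S2 :
    deduce C (crel R (TBin o T1 T2) (TBin o S1 S2)) -> deduce C (crel R T2 S2)
| d_cong3_l o T1 T2 S1 S2 S3 S4 :
    deduce C (CComb (TBin o T1 T2) (TBin o S1 S2) (TBin o S3 S4)) ->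
    deduce C (CComb T1 S1 S3)
| d_cong3_r o T1 T2 S1 S2 S3 S4 :
    deduce C (CComb (TBin o T1 T2) (TBin o S1 S2) (TBin o S3 S4)) ->
    deduce C (CComb T2 S2 S4)
| d_subst T1 T2 T3 S1 S2 S3 :
    deduce C (CComb T1 T2 T3) ->
    deduce C (CEq T1 S1) -> deduce C (CEq T2 S2) -> deduce C (CEq T3 S3) ->
    deduce C (CComb S1 S2 S3)
| d_use1_l T S U1 U2 V1 V2 :
    deduce C (CEq (TChan T U1 U2) (TChan S V1 V2)) -> deduce C (CUse U1 V1)
| d_use1_r T S U1 U2 V1 V2 :
    deduce C (CEq (TChan T U1 U2) (TChan S V1 V2)) -> deduce C (CUse U2 V2)
| d_use2_l T S1 S2 U1 U2 V1 V2 V3 V4 :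
    deduce C (CComb (TChan T U1 U2) (TChan S1 V1 V2) (TChan S2 V3 V4)) ->
    deduce C (CUse U1 (UAdd V1 V3))
| d_use2_r T S1 S2 U1 U2 V1 V2 V3 V4 :
    deduce C (CComb (TChan T U1 U2) (TChan S1 V1 V2) (TChan S2 V3 V4)) ->
    deduce C (CUse U2 (UAdd V2 V4)).

(** * Canonical representatives *)

Definition texpr_order (leT : rel texpr) : Prop :=
  [/\ reflexive leT, antisymmetric leT, transitive leT, total leT
    & forall T a, tproper T -> leT T (TVar a)].

(* [is_crep leT R C T S]: S is the canonical representative of T. *)
Definition is_crep (leT : rel texpr) (R : trel) (C : set constr)
    (T S : texpr) : Prop :=
  deduce C (crel R T S) /\ forall S', deduce C (crel R T S') -> leT S S'.

Definition undef (leT : rel texpr) (R : trel) (C : set constr) : set tvar :=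
  [set a | texprs C (TVar a) /\
           exists S, is_crep leT R C (TVar a) S /\ ~ tproper S].

(** * Completion *)

(* The use variables of an instance are drawn from a supply [nu] indexed by
   the position of the channel constructor and by which of its two uses is
   replaced. *)
Fixpoint instance (t : tvar * tvar -> tvar) (nu : seq bool * bool -> uvar)
    (a : tvar) (T : texpr) : texpr :=
  match T with
  | TVar b => TVar (t (a, b))
  | TInt => TInt
  | TChan T1 _ _ =>
      TChan T1 (UVar (nu ([::], false))) (UVar (nu ([::], true)))
  | TBin o T1 T2 =>
      TBin o (instance t (fun q => nu (false :: q.1, q.2)) a T1)
             (instance t (fun q => nu (true :: q.1, q.2)) a T2)
  end.

(* Canonical representatives form a relation, functional because leT is
   antisymmetric. The instantiation triggered by t(a, b) has its own supply of use variables,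
   [fun q => nu ((a, b), q)]. *)
Inductive completion (leT : rel texpr) (t : tvar * tvar -> tvar)
    (nu : (tvar * tvar) * (seq bool * bool) -> uvar) (C : set constr) :
    set constr :=
| compl_base phi : C phi -> completion leT t nu C phi
| compl_undef a :
    undef leT REq C a ->
    completion leT t nu C (CEq (TVar a) (TVar (t (a, a))))
| compl_instance a b S phi :
    completion leT t nu C phi -> texpr_in_constr (TVar (t (a, b))) phi ->
    is_crep leT RCoh C (TVar b) S ->
    completion leT t nu C
      (CEq (TVar (t (a, b))) (instance t (fun q => nu ((a, b), q)) a S)).

(** * Use constraints and system of equations *)

Definition use_solution (C : set constr) (s : usubst) : Prop :=
  (forall r, r \in domf s <-> uexprs C (UVar r)) /\
  (forall U V, deduce C (CUse U V) ->
     exists k, apply_use s U = Some k /\ apply_use s V = Some k).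

Fixpoint usubst_uexpr (s : usubst) (U : uexpr) : uexpr :=
  match U with
  | UVar r => if s.[? r] is Some k then UConst k else UVar r
  | UConst k => UConst k
  | UAdd U1 U2 => UAdd (usubst_uexpr s U1) (usubst_uexpr s U2)
  end.

Fixpoint usubst_texpr (s : usubst) (T : texpr) : texpr :=
  match T with
  | TVar a => TVar a
  | TInt => TInt
  | TChan T1 U1 U2 =>
      TChan (usubst_texpr s T1) (usubst_uexpr s U1) (usubst_uexpr s U2)
  | TBin o T1 T2 => TBin o (usubst_texpr s T1) (usubst_texpr s T2)
  end.

(* [system_solution leT C su st]: st solves the equations
   a = su crep_=(C, a), for the type variables a of expr(C). Uniqueness of the
   solution is not assumed. *)
Definition system_solution (leT : rel texpr) (C : set constr)
    (su : usubst) (st : tsubst) : Prop :=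
  (forall a, a \in domf st <-> texprs C (TVar a)) /\
  (forall a S, texprs C (TVar a) -> is_crep leT REq C (TVar a) S ->
     satisfies (Subst st [fmap]) (CEq (TVar a) (usubst_texpr su S))).

(* Main.v *)
(* A projection sends t(a, b) to b, and the fresh use variables of an instance
   to the uses that they replace. It turns every derivation of T = S or T ~ S
   from the completion into a derivation of the coherence of the projections
   from C, so proper expressions coherent in the completion have the same
   topmost constructor. In the completion every type variable equals a proper
   expression: through t(a, a) and crep_~ if it has no proper crep_= in C.
   Hence every derivable equation or combination can be rewritten between
   proper expressions and then decomposed by the congruence rules, which is
   what a coinductive proof that its solution satisfies it requires. *)

Require Import Defs.
From mathcomp Require Import all_boot ssrint finmap.
From mathcomp Require Import boolp classical_sets.
From mathcomp Require Import cardinality.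

Set Implicit Arguments.
Unset Strict Implicit.
Unset Printing Implicit Defensive.

Local Open Scope classical_set_scope.

(** * Subexpressions *)

Lemma texpr_in_texpr_refl T : texpr_in_texpr T T.
Proof. by case: T => *; left. Qed.

Lemma texpr_in_texpr_trans R S T :
  texpr_in_texpr R S -> texpr_in_texpr S T -> texpr_in_texpr R T.
Proof.
move=> RS; elim: T => /= [a|| T1 IH U V|o T1 IH1 T2 IH2].
- by case=> // SE; move: RS; rewrite SE.
- by case=> // SE; move: RS; rewrite SE.
- by case=> [SE|/IH ?]; [move: RS; rewrite SE | right].
- case=> [SE|[/IH1 ?|/IH2 ?]]; first by move: RS; rewrite SE.
  + by right; left.
  + by right; right.
Qed.

Lemma uexpr_in_texpr_trans W S T :
  uexpr_in_texpr W S -> texpr_in_texpr S T -> uexpr_in_texpr W T.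
Proof.
move=> WS; elim: T => /= [a|| T1 IH U V|o T1 IH1 T2 IH2].
- by case=> // SE; move: WS; rewrite SE.
- by case=> // SE; move: WS; rewrite SE.
- by case=> [SE|/IH ?]; [move: WS; rewrite SE | apply: Or31].
- case=> [SE|[/IH1 ?|/IH2 ?]]; first by move: WS; rewrite SE.
  + by left.
  + by right.
Qed.

Lemma texprs_sub C S T : texprs C T -> texpr_in_texpr S T -> texprs C S.
Proof.
move=> [phi [Cphi inphi]] ST; exists phi; split=> //.
case: phi inphi {Cphi} => //= [T1 T2|T1 T2 T3|T1 T2];
  case=> H; have K := texpr_in_texpr_trans ST H;
  by [left|right|apply: Or31|apply: Or32|apply: Or33].
Qed.

Lemma uexprs_sub C U T : texprs C T -> uexpr_in_texpr U T -> uexprs C U.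
Proof.
move=> [phi [Cphi inphi]] ST; exists phi; split=> //.
case: phi inphi {Cphi} => //= [T1 T2|T1 T2 T3|T1 T2];
  case=> H; have K := uexpr_in_texpr_trans ST H;
  by [left|right|apply: Or31|apply: Or32|apply: Or33].
Qed.

Lemma texprs_mono C C' : C `<=` C' -> texprs C `<=` texprs C'.
Proof. by move=> CC' T [phi [/CC' ? ?]]; exists phi. Qed.

Lemma uexprs_mono C C' : C `<=` C' -> uexprs C `<=` uexprs C'.
Proof. by move=> CC' T [phi [/CC' ? ?]]; exists phi. Qed.

Lemma texprs_chan C T U V : texprs C (TChan T U V) -> texprs C T.
Proof. by move/texprs_sub; apply; right; apply: texpr_in_texpr_refl. Qed.

Lemma texprs_binl C o T S : texprs C (TBin o T S) -> texprs C T.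
Proof. by move/texprs_sub; apply; right; left; apply: texpr_in_texpr_refl. Qed.

Lemma texprs_binr C o T S : texprs C (TBin o T S) -> texprs C S.
Proof. by move/texprs_sub; apply; right; right; apply: texpr_in_texpr_refl. Qed.

Lemma texprs_crel R C T S : C (crel R T S) -> texprs C T /\ texprs C S.
Proof.
move=> CTS; split; exists (crel R T S); split=> //.
  by case: {CTS} R => /=; left; apply: texpr_in_texpr_refl.
by case: {CTS} R => /=; right; apply: texpr_in_texpr_refl.
Qed.

Lemma texprs_comb C T S1 S2 : C (CComb T S1 S2) ->
  [/\ texprs C T, texprs C S1 & texprs C S2].
Proof.
by move=> CT; split; exists (CComb T S1 S2); split=> //=;
  [apply: Or31|apply: Or32|apply: Or33]; apply: texpr_in_texpr_refl.
Qed.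

(** Use constraints are exempt because rule (use 2) forms sums that need not occur in the constraint
    set. *)
Definition texprs_of (phi : constr) (A : set texpr) : Prop :=
  match phi with
  | CEq T1 T2 | CCoh T1 T2 => A T1 /\ A T2
  | CComb T1 T2 T3 => [/\ A T1, A T2 & A T3]
  | CUse _ _ => True
  end.

Lemma texprs_of_crel R T S A : texprs_of (crel R T S) A = (A T /\ A S).
Proof. by case: R. Qed.

(** Besides axioms, only reflexivity introduces type expressions, and it is restricted to
    [texprs C]; the other rules rearrange or decompose those already present. Hence every class of
    deduced equality or coherence is finite when [C] is. *)
Lemma deduce_texprs C phi : deduce C phi -> texprs_of phi (texprs C).
Proof.
elim=> {phi} /=.
- case=> [T S|T S1 S2|T S|//] /=; first exact: (@texprs_crel REq).
    exact: texprs_comb.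
  exact: (@texprs_crel RCoh).
- by move=> R T CT; rewrite texprs_of_crel.
- by move=> R T S _; rewrite !texprs_of_crel => -[].
- by move=> R T1 T2 T3 _ + _; rewrite !texprs_of_crel => -[? _] [].
- by [].
- by move=> T S1 S2 _ [].
- by move=> T S1 S2 _ [].
- by move=> T S U1 U2 V1 V2 _ [/texprs_chan ? /texprs_chan].
- move=> R o T1 T2 S1 S2 _; rewrite !texprs_of_crel.
  by move=> [/texprs_binl ? /texprs_binl].
- move=> R o T1 T2 S1 S2 _; rewrite !texprs_of_crel.
  by move=> [/texprs_binr ? /texprs_binr].
- by move=> o T1 T2 S1 S2 S3 S4 _ [/texprs_binl ? /texprs_binl ? /texprs_binl].
- by move=> o T1 T2 S1 S2 S3 S4 _ [/texprs_binr ? /texprs_binr ? /texprs_binr].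
- by move=> T1 T2 T3 S1 S2 S3 _ _ _ [_ ?] _ [_ ?] _ [_ ?].
- by [].
- by [].
- by [].
- by [].
Qed.

Lemma deduce_mono C C' phi : C `<=` C' -> deduce C phi -> deduce C' phi.
Proof.
move=> CC'; elim=> {phi}.
- by move=> phi /CC'; apply: d_axiom.
- by move=> R T /(texprs_mono CC'); apply: d_refl.
all: by eauto using deduce.
Qed.

(** * Finiteness and canonical representatives *)

Lemma finite_subexprs T : finite_set [set S | texpr_in_texpr S T].
Proof.
elim: T => /= [a||T IH U V|o T1 IH1 T2 IH2].
- by apply: sub_finite_set (finite_set1 (TVar a)) => S /= [].
- by apply: sub_finite_set (finite_set1 TInt) => S /= [].
- apply: (@sub_finite_set _ _ ([set TChan T U V] `|`
    [set S | texpr_in_texpr S T])) => //.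
  by rewrite finite_setU; split=> //; apply: finite_set1.
- apply: (@sub_finite_set _ _ ([set TBin o T1 T2] `|`
    ([set S | texpr_in_texpr S T1] `|` [set S | texpr_in_texpr S T2]))) => //.
  by rewrite !finite_setU; split=> //; apply: finite_set1.
Qed.

Lemma finite_texprs C : finite_set C -> finite_set (texprs C).
Proof.
move=> finC; apply: (@sub_finite_set _ _
  (\bigcup_(phi in C) [set T | texpr_in_constr T phi])).
  by move=> T [phi [? ?]]; exists phi.
apply: bigcup_finite => // -[T1 T2|T1 T2 T3|T1 T2|U V] _ /=.
- apply: (@sub_finite_set _ _ ([set S | texpr_in_texpr S T1] `|`
    [set S | texpr_in_texpr S T2])) => //.
  by rewrite finite_setU; split; apply: finite_subexprs.
- apply: (@sub_finite_set _ _ ([set S | texpr_in_texpr S T1] `|`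
    [set S | texpr_in_texpr S T2] `|` [set S | texpr_in_texpr S T3])).
    by move=> S []; [left; left|left; right|right].
  by rewrite !finite_setU; do !split; apply: finite_subexprs.
- apply: (@sub_finite_set _ _ ([set S | texpr_in_texpr S T1] `|`
    [set S | texpr_in_texpr S T2])) => //.
  by rewrite finite_setU; split; apply: finite_subexprs.
- exact: sub_finite_set (finite_set0 _).
Qed.

Lemma finite_min (A : Type) (leA : rel A) (B : set A) :
  reflexive leA -> transitive leA -> total leA ->
  finite_set B -> B !=set0 -> exists2 x, B x & forall y, B y -> leA x y.
Proof.
(* A choice structure on [A], which exists classically, lets the finite set be enumerated by a
   list. *)
elim/Pchoice: A => A in leA B *.
move=> le_refl le_trans le_total /finite_seqP[s ->] [x0 /= x0s].
elim: s x0 x0s => // a s IH _ _.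
case: s IH => [_|b s IH].
  by exists a => [|y]; rewrite /= inE // => /eqP ->.
have [x xs xmin] := IH b (mem_head _ _).
case/orP: (le_total a x) => [ax|xa].
  exists a => [|y]; rewrite /= inE ?eqxx // => /orP[/eqP->//|ys].
  exact: le_trans ax (xmin _ ys).
exists x => [|y]; rewrite /= inE; first by rewrite [_ \in _]xs orbT.
by move=> /orP[/eqP->//|/xmin].
Qed.

Lemma is_crep_exists leT R C T : texpr_order leT -> finite_set C ->
  texprs C T -> exists S, is_crep leT R C T S.
Proof.
move=> [le_refl _ le_trans le_total _] finC CT.
have [S TS Smin] : exists2 S, deduce C (crel R T S) &
    forall S', deduce C (crel R T S') -> leT S S'.
  apply: finite_min => //; last by exists T; apply: d_refl.
  apply: sub_finite_set (finite_texprs finC) => S /= /deduce_texprs.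
  by rewrite texprs_of_crel => -[].
by exists S.
Qed.

Lemma is_crep_inj leT R C T S S' : texpr_order leT ->
  is_crep leT R C T S -> is_crep leT R C T S' -> S = S'.
Proof.
move=> [_ le_anti _ _ _] [TS Smin] [TS' S'min].
by apply: le_anti; rewrite Smin ?S'min.
Qed.

(** A variable below the proper [T] would equal it by antisymmetry, since proper expressions lie
    below all variables. *)
Lemma crep_proper leT R C a S T : texpr_order leT -> tproper T ->
  deduce C (crel R (TVar a) T) -> is_crep leT R C (TVar a) S -> tproper S.
Proof.
move=> [_ le_anti _ _ le_var] Tproper aT [_ Smin] b Sb.
apply: (Tproper b); rewrite -Sb; apply: le_anti.
by rewrite Smin // Sb le_var.
Qed.

(** * Coinduction on trees *)

Lemma teq_refl s : teq s s.
Proof. by move: s; cofix IH => -[|s k1 k2|o s1 s2]; constructor. Qed.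

Lemma teq_sym s s' : teq s s' -> teq s' s.
Proof.
move: s s'; cofix IH => s s' [|r r' k1 k2 rr'|o r1 r2 r1' r2' rr1 rr2];
  by constructor; apply: IH.
Qed.

Lemma teq_trans s1 s2 s3 : teq s1 s2 -> teq s2 s3 -> teq s1 s3.
Proof.
move: s1 s2 s3; cofix IH => s1 s2 s3.
case=> [|r r' k1 k2 rr'|o r1 r2 r1' r2' rr1 rr2] H; inversion H; subst;
  by constructor; apply: IH; eassumption.
Qed.

(** The functor whose greatest fixed point is [teq]. Coinduction through it has no guardedness
    condition, so transitivity and case analysis may be used freely to show that a relation is a
    bisimulation. *)
Inductive teq_step (R : tree -> tree -> Prop) : tree -> tree -> Prop :=
| teq_step_int : teq_step R Int Int
| teq_step_chan s s' k1 k2 : R s s' -> teq_step R (Chan s k1 k2) (Chan s' k1 k2)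
| teq_step_bin o s1 s2 s1' s2' : R s1 s1' -> R s2 s2' ->
    teq_step R (Bin o s1 s2) (Bin o s1' s2').

Lemma teq_coind (R : tree -> tree -> Prop) :
  (forall s s', R s s' -> teq_step R s s') -> forall s s', R s s' -> teq s s'.
Proof.
move=> step; cofix IH => s s' /step[|r r' k1 k2 rr'|o r1 r2 r1' r2' rr1 rr2];
  by constructor; apply: IH.
Qed.

(** Once [R] absorbs bisimilarity, both trees may be replaced by bisimilar ones before their roots
    are compared. *)
Lemma teq_step_teq (R : tree -> tree -> Prop) r r' s s' :
  (forall r r' s s', teq r r' -> teq s s' -> R r' s' -> R r s) ->
  teq r r' -> teq s s' -> teq_step R r' s' -> teq_step R r s.
Proof.
move=> Rteq rr' ss' rs; move: rr' ss'; case: rs => [|p q k1 k2 pq|o p1 p2 q1 q2 ? ?];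
  move=> H1 H2; inversion H1; inversion H2; constructor;
  by apply: Rteq; eassumption.
Qed.

Inductive tcomb_step (R : tree -> tree -> tree -> Prop) :
  tree -> tree -> tree -> Prop :=
| tcomb_step_int : tcomb_step R Int Int Int
| tcomb_step_chan s s1 s2 k1 k2 k3 k4 : teq s1 s -> teq s2 s ->
    tcomb_step R (Chan s1 k1 k2) (Chan s2 k3 k4)
      (Chan s (use_add k1 k3) (use_add k2 k4))
| tcomb_step_bin o r1 r2 s1 s2 q1 q2 : R r1 s1 q1 -> R r2 s2 q2 ->
    tcomb_step R (Bin o r1 r2) (Bin o s1 s2) (Bin o q1 q2).

Lemma tcomb_coind (R : tree -> tree -> tree -> Prop) :
  (forall r s q, R r s q -> tcomb_step R r s q) ->
  forall r s q, R r s q -> tcomb r s q.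
Proof.
move=> step; cofix IH => r s q.
case/step=> [|p p1 p2 k1 k2 k3 k4 ? ?|o r1 r2 s1 s2 q1 q2 ? ?];
  by constructor; by [|apply: IH].
Qed.

Lemma tcomb_step_teq (R : tree -> tree -> tree -> Prop) r r' s s' q q' :
  (forall r r' s s' q q', teq r r' -> teq s s' -> teq q q' ->
     R r' s' q' -> R r s q) ->
  teq r r' -> teq s s' -> teq q q' -> tcomb_step R r' s' q' ->
  tcomb_step R r s q.
Proof.
move=> Rteq rr' ss' qq' H; move: rr' ss' qq'.
case: H => [|p p1 p2 k1 k2 k3 k4 E1 E2|o r1 r2 s1 s2 q1 q2 ? ?];
  move=> H1 H2 H3; inversion H1; inversion H2; inversion H3; subst; constructor.
- by eauto using teq_sym, teq_trans.
- by eauto using teq_sym, teq_trans.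
- by apply: Rteq; eassumption.
- by apply: Rteq; eassumption.
Qed.

(** * Generated constraints *)

Fixpoint uexpr_over (X : {fset var}) (U : uexpr) : bool :=
  match U with
  | UVar r => VU r \in X
  | UConst _ => true
  | UAdd U1 U2 => uexpr_over X U1 && uexpr_over X U2
  end.

Fixpoint texpr_over (X : {fset var}) (T : texpr) : bool :=
  match T with
  | TVar a => VT a \in X
  | TInt => true
  | TChan T1 U1 U2 => [&& texpr_over X T1, uexpr_over X U1 & uexpr_over X U2]
  | TBin _ T1 T2 => texpr_over X T1 && texpr_over X T2
  end.

(* Generation never produces coherence or use constraints. This matters: for a
   coherence constraint one would have to exhibit a regular combination. *)
Definition generated_over (X : {fset var}) (phi : constr) : bool :=
  match phi with
  | CEq T1 T2 => texpr_over X T1 && texpr_over X T2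
  | CComb T1 T2 T3 => [&& texpr_over X T1, texpr_over X T2 & texpr_over X T3]
  | CCoh _ _ | CUse _ _ => false
  end.

Definition env_over (X : {fset var}) (D : env) : Prop :=
  forall u T, fnd D u = Some T -> texpr_over X T.

Definition generated (X : {fset var}) (C : set constr) : Prop :=
  finite_set C /\ forall phi, C phi -> generated_over X phi.

Lemma uexpr_over_mono (X Y : {fset var}) U :
  {subset X <= Y} -> uexpr_over X U -> uexpr_over Y U.
Proof.
by move=> XY; elim: U => //= [r /XY//|U1 IH1 U2 IH2 /andP[/IH1-> /IH2->]].
Qed.

Lemma texpr_over_mono (X Y : {fset var}) T :
  {subset X <= Y} -> texpr_over X T -> texpr_over Y T.
Proof.
move=> XY; elim: T => //= [a /XY//|T IH U V|o T1 IH1 T2 IH2].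
  by move=> /and3P[/IH->]; do 2![move=> /(uexpr_over_mono XY)->].
by move=> /andP[/IH1-> /IH2->].
Qed.

Lemma env_over_mono (X Y : {fset var}) D :
  {subset X <= Y} -> env_over X D -> env_over Y D.
Proof. by move=> XY XD u T /XD; apply: texpr_over_mono. Qed.

Lemma generated_mono (X Y : {fset var}) C :
  {subset X <= Y} -> generated X C -> generated Y C.
Proof.
move=> XY [finC XC]; split=> // phi /XC.
case: phi => //= [T1 T2 /andP[]|T1 T2 T3 /and3P[]];
  by do ![move=> /(texpr_over_mono XY)->].
Qed.

Lemma texpr_over_sub X S T :
  texpr_over X T -> texpr_in_texpr S T -> texpr_over X S.
Proof.
elim: T => /= [a|| T IH U V|o T1 IH1 T2 IH2].
- by move=> ? [->|].
- by move=> ? [->|].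
- by move=> XT [->//|]; apply: IH; case/and3P: XT.
- by move=> XT [->//|[]]; [apply: IH1|apply: IH2]; case/andP: XT.
Qed.

Lemma generated_texprs X C T : generated X C -> texprs C T -> texpr_over X T.
Proof.
move=> [_ XC] [phi [/XC]]; case: phi => //= [T1 T2|T1 T2 T3].
  by move=> /andP[? ?] []; apply: texpr_over_sub.
by move=> /and3P[? ? ?] []; apply: texpr_over_sub.
Qed.

Lemma env_over0 X : env_over X [fmap]%fmap.
Proof. by move=> u T; rewrite fnd_fmap0. Qed.

Lemma env_over_set X (D : env) u T :
  env_over X D -> texpr_over X T -> env_over X (D.[u <- T])%fmap.
Proof. by move=> XD XT v S; rewrite fnd_set; case: eqP => [_ [<-]|_ /XD]. Qed.

Lemma env_over_setP X (D : env) u T : u \notin domf D ->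
  env_over X (D.[u <- T])%fmap -> env_over X D /\ texpr_over X T.
Proof.
move=> uD XD; split=> [v S DvS|].
  apply: (XD v); rewrite fnd_set; case: eqP => // vu.
  by move: DvS; rewrite vu not_fnd.
by apply: (XD u); rewrite fnd_set eqxx.
Qed.

Lemma generated0 X : generated X set0.
Proof. by split. Qed.

Lemma generatedU X C C' :
  generated X C -> generated X C' -> generated X (C `|` C').
Proof.
move=> [finC XC] [finC' XC']; split; first by rewrite finite_setU.
by move=> phi [/XC|/XC'].
Qed.

Lemma generated1 X phi : generated_over X phi -> generated X [set phi].
Proof. by move=> Xphi; split=> [|_ ->//]; apply: finite_set1. Qed.

(** [X] records only the variables that merging introduces, whereas the merged environments bring
    variables of other premises; [Y] covers both. *)
Lemma merge_generated D1 D2 D C X (Y : {fset var}) :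
  Defs.merge D1 D2 D C X -> {subset X <= Y} ->
  env_over Y D1 -> env_over Y D2 -> env_over Y D /\ generated Y C.
Proof.
elim=> {D1 D2 D C X} [D1 D2 _ _ YD1 YD2|D1 D2 D C X u T1 T2 a _ IH uD1 uD2 _ XY].
  split; last exact: generated0.
  by move=> v T; rewrite fnd_cat; case: ifP => _; [apply: YD2|apply: YD1].
move=> /(env_over_setP uD1)[YD1 YT1] /(env_over_setP uD2)[YD2 YT2].
have [|YD YC] := IH _ YD1 YD2.
  by move=> v vX; apply: XY; rewrite !inE vX orbT.
have Ya : VT a \in Y by apply: XY; rewrite !inE eqxx.
split; first exact: env_over_set.
by apply: generatedU => //; apply: generated1; rewrite /= Ya YT1.
Qed.

Lemma unify_generated D1 D2 D C (Y : {fset var}) :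
  unify D1 D2 D C -> env_over Y D1 -> env_over Y D2 ->
  env_over Y D /\ generated Y C.
Proof.
elim=> {D1 D2 D C} [_ _|D1 D2 D C u T1 T2 _ IH uD1 uD2].
  by split; [apply: env_over0|apply: generated0].
move=> /(env_over_setP uD1)[YD1 YT1] /(env_over_setP uD2)[YD2 YT2].
have [YD YC] := IH YD1 YD2.
split; first exact: env_over_set.
by apply: generatedU => //; apply: generated1; rewrite /= YT1.
Qed.

Lemma subset_add_vars vs (X : {fset var}) : {subset X <= add_vars vs X}.
Proof. by move=> v vX; rewrite !inE vX orbT. Qed.

Lemma mem_add_vars v vs (X : {fset var}) : v \in vs -> v \in add_vars vs X.
Proof. by move=> vvs; rewrite !inE vvs. Qed.

Lemma egen_generated e T D C X : egen e T D C X ->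
  [/\ texpr_over X T, env_over X D & generated X C].
Proof.
elim=> {e T D C X}.
- by move=> _; split=> //; apply: env_over0.
- move=> u a; have aX : VT a \in add_vars [:: VT a] fset0 by rewrite !inE eqxx.
  by split=> //; apply: env_over_set => //; apply: env_over0.
- move=> e T D C X a _ [XT XD XC] _.
  have XY := @subset_add_vars [:: VT a] X.
  split; [|exact: env_over_mono XD|exact: generated_mono XC].
  by rewrite /= (texpr_over_mono XY XT) mem_add_vars ?mem_head.
- move=> e T D C X a _ [XT XD XC] _.
  have XY := @subset_add_vars [:: VT a] X.
  split; [|exact: env_over_mono XD|exact: generated_mono XC].
  by rewrite /= (texpr_over_mono XY XT) mem_add_vars ?mem_head.
- move=> e T D C X a b _ [XT XD XC] _.
  have XY := @subset_add_vars [:: VT a; VT b] X.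
  have Ya : VT a \in add_vars [:: VT a; VT b] X by rewrite !inE eqxx.
  have Yb : VT b \in add_vars [:: VT a; VT b] X by rewrite !inE eqxx orbT.
  split=> //; first exact: env_over_mono XD.
  apply: generatedU; first exact: generated_mono XC.
  apply: generatedU; apply: generated1; rewrite /= ?Ya ?Yb //.
  by rewrite (texpr_over_mono XY XT).
- move=> e T D C X a b _ [XT XD XC] _.
  have XY := @subset_add_vars [:: VT a; VT b] X.
  have Ya : VT a \in add_vars [:: VT a; VT b] X by rewrite !inE eqxx.
  have Yb : VT b \in add_vars [:: VT a; VT b] X by rewrite !inE eqxx orbT.
  split=> //; first exact: env_over_mono XD.
  apply: generatedU; first exact: generated_mono XC.
  apply: generatedU; apply: generated1; rewrite /= ?Ya ?Yb //.
  by rewrite (texpr_over_mono XY XT).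
- move=> e1 e2 T1 T2 D1 D2 D C1 C2 C3 X1 X2 X3 _ [XT1 XD1 XC1] _ [XT2 XD2 XC2].
  move=> mrg _; set Y := (X1 `|` X2 `|` X3)%fset.
  have XY1 : {subset X1 <= Y} by move=> v; rewrite !inE => ->.
  have XY2 : {subset X2 <= Y} by move=> v; rewrite !inE => ->; rewrite !orbT.
  have XY3 : {subset X3 <= Y} by move=> v; rewrite !inE => ->; rewrite !orbT.
  have [YD YC3] := merge_generated mrg XY3
    (env_over_mono XY1 XD1) (env_over_mono XY2 XD2).
  split=> //=.
    by rewrite (texpr_over_mono XY1 XT1) (texpr_over_mono XY2 XT2).
  apply: generatedU YC3.
  by apply: generatedU; [apply: generated_mono XC1|apply: generated_mono XC2].
Qed.

(** This confines the generated constraints to the recorded variables, which the ranges of [t] and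
    [nu] are later assumed to avoid. *)
Lemma pgen_generated P D C X : pgen P D C X -> env_over X D /\ generated X C.
Proof.
elim=> {P D C X}.
- by split; [apply: env_over0|apply: generated0].
- move=> e x P T S D1 D2 D C1 C2 C3 X1 X2 X3 r1 r2 /egen_generated[XT XD1 XC1].
  move=> xD2 _ [/(env_over_setP xD2)[XD2 XS] XC2] mrg _ _; set Y := add_vars _ _.
  have XY1 : {subset X1 <= Y} by move=> v; rewrite !inE => ->; rewrite !orbT.
  have XY2 : {subset X2 <= Y} by move=> v; rewrite !inE => ->; rewrite !orbT.
  have XY3 : {subset X3 <= Y} by move=> v; rewrite !inE => ->; rewrite !orbT.
  have [YD YC3] := merge_generated mrg XY3
    (env_over_mono XY1 XD1) (env_over_mono XY2 XD2).
  split=> //; apply: generatedU.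
    apply: generatedU YC3.
    by apply: generatedU; [apply: generated_mono XC1|apply: generated_mono XC2].
  apply: generated1; rewrite /= (texpr_over_mono XY1 XT) (texpr_over_mono XY2 XS).
  by rewrite !inE !eqxx !orbT.
- move=> e f T S D1 D2 D C1 C2 C3 X1 X2 X3 r1 r2 /egen_generated[XT XD1 XC1].
  move=> /egen_generated[XS XD2 XC2] mrg _ _; set Y := add_vars _ _.
  have XY1 : {subset X1 <= Y} by move=> v; rewrite !inE => ->; rewrite !orbT.
  have XY2 : {subset X2 <= Y} by move=> v; rewrite !inE => ->; rewrite !orbT.
  have XY3 : {subset X3 <= Y} by move=> v; rewrite !inE => ->; rewrite !orbT.
  have [YD YC3] := merge_generated mrg XY3
    (env_over_mono XY1 XD1) (env_over_mono XY2 XD2).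
  split=> //; apply: generatedU.
    apply: generatedU YC3.
    by apply: generatedU; [apply: generated_mono XC1|apply: generated_mono XC2].
  apply: generated1; rewrite /= (texpr_over_mono XY1 XT) (texpr_over_mono XY2 XS).
  by rewrite !inE !eqxx !orbT.
- move=> P D D' C C' X X' _ [XD XC] mrg _; set Y := (X `|` X')%fset.
  have XY : {subset X <= Y} by move=> v; rewrite !inE => ->.
  have XY' : {subset X' <= Y} by move=> v; rewrite !inE => ->; rewrite !orbT.
  have [YD' YC'] := merge_generated mrg XY'
    (env_over_mono XY XD) (env_over_mono XY XD).
  by split=> //; apply: generatedU YC'; apply: generated_mono XC.
- move=> P1 P2 D1 D2 D C1 C2 C3 X1 X2 X3 _ [XD1 XC1] _ [XD2 XC2] mrg _.
  set Y := (X1 `|` X2 `|` X3)%fset.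
  have XY1 : {subset X1 <= Y} by move=> v; rewrite !inE => ->; rewrite ?orbT.
  have XY2 : {subset X2 <= Y} by move=> v; rewrite !inE => ->; rewrite !orbT.
  have XY3 : {subset X3 <= Y} by move=> v; rewrite !inE => ->; rewrite !orbT.
  have [YD YC3] := merge_generated mrg XY3
    (env_over_mono XY1 XD1) (env_over_mono XY2 XD2).
  split=> //; apply: generatedU YC3.
  by apply: generatedU; [apply: generated_mono XC1|apply: generated_mono XC2].
- move=> a P T D C X b r aD _ [/(env_over_setP aD)[XD XT] XC] _.
  have XY := @subset_add_vars [:: VT b; VU r] X.
  split; first exact: env_over_mono XD.
  apply: generatedU; first exact: generated_mono XC.
  apply: generated1; rewrite /= (texpr_over_mono XY XT).
  by rewrite !inE !eqxx !orbT.
- move=> e xl Pl xr Pr T Tl Tr D1 Dl Dr D2 D C1 Cl Cr C2 C3 X1 Xl Xr X3.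
  move=> /egen_generated[XT XD1 XC1].
  move=> xD _ [/(env_over_setP xD)[XDl XTl] XCl].
  move=> yD _ [/(env_over_setP yD)[XDr XTr] XCr] uni mrg _.
  set Y := (X1 `|` Xl `|` Xr `|` X3)%fset.
  have XY1 : {subset X1 <= Y} by move=> v; rewrite !inE => ->; rewrite ?orbT.
  have XYl : {subset Xl <= Y} by move=> v; rewrite !inE => ->; rewrite !orbT.
  have XYr : {subset Xr <= Y} by move=> v; rewrite !inE => ->; rewrite !orbT.
  have XY3 : {subset X3 <= Y} by move=> v; rewrite !inE => ->; rewrite !orbT.
  have [YD2 YC2] := unify_generated uni
    (env_over_mono XYl XDl) (env_over_mono XYr XDr).
  have [YD YC3] := merge_generated mrg XY3 (env_over_mono XY1 XD1) YD2.
  split=> //.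
  do ?[apply: generatedU => //]; last 1 first.
  + apply: generated1; rewrite /= (texpr_over_mono XY1 XT).
    by rewrite (texpr_over_mono XYl XTl) (texpr_over_mono XYr XTr).
  + exact: generated_mono XC1.
  + exact: generated_mono XCl.
  + exact: generated_mono XCr.
- move=> P D C X u a _ [XD XC] uD _.
  have XY := @subset_add_vars [:: VT a] X.
  have Ya : VT a \in add_vars [:: VT a] X by rewrite mem_add_vars ?mem_head.
  split; first by apply: env_over_set => //; apply: env_over_mono XD.
  apply: generatedU; first exact: generated_mono XC.
  by apply: generated1; rewrite /= Ya.
- by [].
Qed.

(** * Completion *)

Lemma generated_freshN X C (t : tvar * tvar -> tvar) p T :
  generated X C -> (forall p, VT (t p) \notin X) ->
  texprs C T -> ~ texpr_in_texpr (TVar (t p)) T.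
Proof.
move=> XC tX CT /(texpr_over_sub (generated_texprs XC CT)) /=.
exact/negP.
Qed.

(** [T] contains no variable [t p], so the only ones in its instance are those that [instance]
    creates, all with first component [a]. *)
Lemma instance_tvar C X t nu a T p :
  generated X C -> injective t -> (forall p, VT (t p) \notin X) ->
  texprs C T -> texpr_in_texpr (TVar (t p)) (instance t nu a T) -> p.1 = a.
Proof.
move=> XC tI tX; elim: T nu => /= [b||T IH U V|o T1 IH1 T2 IH2] nu CT.
- by case=> [bE|//]; have -> : p = (a, b) by apply: tI; case: bE.
- by case.
- by case=> // /(generated_freshN XC tX (texprs_chan CT)).
- case=> // -[]; first by apply: IH1; apply: texprs_binl CT.
  by apply: IH2; apply: texprs_binr CT.
Qed.

(** New variables start as [t (a, a)] with [a] in [C], and instantiation changes only the second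
    component. *)
Lemma completion_fst leT X C t nu phi p :
  generated X C -> injective t -> (forall p, VT (t p) \notin X) ->
  completion leT t nu C phi -> texpr_in_constr (TVar (t p)) phi ->
  texprs C (TVar p.1).
Proof.
move=> XC tI tX phiC; elim: phiC p => {phi} [phi Cphi|a [Ca _]|a b T phi _ IH bphi bT] p.
- move=> pphi; have CT : texprs C (TVar (t p)) by exists phi.
  by case: (generated_freshN XC tX CT (texpr_in_texpr_refl _)).
- move=> /= [[pE|//]|[pE|//]].
    by case: (generated_freshN XC tX Ca (p := p)); left.
  by have -> : p = (a, a) by apply: tI; case: pE.
- move=> [[pE|//]|].
    have -> : p = (a, b) by apply: tI; case: pE.
    exact: IH bphi.
  have [_ CT] := deduce_texprs bT.1.
  by move=> /(instance_tvar XC tI tX CT)->; apply: IH bphi.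
Qed.

(** A constraint added to [C] is determined by a variable [a] of [C], or by two variables and an
    expression of [C]. Finiteness makes canonical representatives exist in the completion too. *)
Lemma finite_completion leT X C t nu :
  generated X C -> injective t -> (forall p, VT (t p) \notin X) ->
  finite_set (completion leT t nu C).
Proof.
move=> XC tI tX; have finC := finite_texprs XC.1.
pose V := [set a | texprs C (TVar a)].
have finV : finite_set V.
  (* The value 0 on expressions that are not variables is arbitrary: the image only has to contain
     [V]. *)
  apply: sub_finite_set (finite_image (fun T => if T is TVar a then a else 0) finC).
  by move=> a Va; exists (TVar a).
pose loop a := CEq (TVar a) (TVar (t (a, a))).
pose inst (q : tvar * tvar * texpr) := CEq (TVar (t (q.1.1, q.1.2)))
  (instance t (fun r => nu ((q.1.1, q.1.2), r)) q.1.1 q.2).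
apply: (@sub_finite_set _ _ (C `|` loop @` V `|` inst @` (V `*` V `*` texprs C))).
  move=> _ [phi Cphi|a [Ca _]|a b T phi phiC bphi bT].
  - by left; left.
  - by left; right; exists a.
  - have [Cb CT] := deduce_texprs bT.1.
    have Ca := completion_fst XC tI tX phiC bphi.
    by right; exists (a, b, T).
rewrite !finite_setU; split; first by split; [exact: XC.1|apply: finite_image].
by apply: finite_image; do ?[apply: finite_setX].
Qed.

(** * Projecting the completion back onto the constraints *)

(** Choice turns a partial function, given by its graph, into a total one with default [d]. The
    projections are inverses of [t] and [nu] built this way. *)
Lemma functional_extension (A B : Type) (Q : A -> B -> Prop) (d : A -> B) :
  (forall x y y', Q x y -> Q x y' -> y = y') ->
  exists f : A -> B, (forall x y, Q x y -> f x = y) /\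
    (forall x, (forall y, ~ Q x y) -> f x = d x).
Proof.
move=> Qfun; have total x : exists y, (forall y', Q x y' -> y = y') /\
    ((forall y', ~ Q x y') -> y = d x).
  have [[y Qxy]|nQ] := pselect (exists y, Q x y).
    by exists y; split=> [y' /(Qfun _ _ _ Qxy)//|/(_ y)].
  by exists (d x); split=> // y' Qxy'; case: nQ; exists y'.
have [f fP] := choice total.
by exists f; split=> [x y Qxy|x nQ]; [exact: (fP x).1|exact: (fP x).2].
Qed.

(** The addresses are those by which [instance] draws from its supply; like [instance], it does not
    enter the payload of a channel. *)
Fixpoint use_at (T : texpr) (q : seq bool) (c : bool) : option uexpr :=
  match T, q with
  | TChan _ U V, [::] => Some (if c then V else U)
  | TBin _ T1 T2, b :: q' => use_at (if b then T2 else T1) q' c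
  | _, _ => None
  end.

(** Sums are left alone: the uses introduced by [instance] are bare variables, and on expressions
    over the generated variables the projection is to be the identity. *)
Definition proj_uexpr (fu : uvar -> uexpr) (U : uexpr) : uexpr :=
  if U is UVar r then fu r else U.

Fixpoint proj (ft : tvar -> tvar) (fu : uvar -> uexpr) (T : texpr) : texpr :=
  match T with
  | TVar a => TVar (ft a)
  | TInt => TInt
  | TChan T1 U V => TChan (proj ft fu T1) (proj_uexpr fu U) (proj_uexpr fu V)
  | TBin o T1 T2 => TBin o (proj ft fu T1) (proj ft fu T2)
  end.

(* [ft] and [fu] undo instantiation: t(a, b) goes back to b, and each use
   variable of an instance goes back to the use expression that it replaced in
   the canonical representative. *)
Definition undoes leT (X : {fset var}) C (t : tvar * tvar -> tvar)
    (nu : (tvar * tvar) * (seq bool * bool) -> uvar)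
    (ft : tvar -> tvar) (fu : uvar -> uexpr) : Prop :=
  [/\ forall p, ft (t p) = p.2,
      forall a, (forall p, a <> t p) -> ft a = a,
      forall r, VU r \in X -> fu r = UVar r
    & forall p q c T U, is_crep leT RCoh C (TVar p.2) T ->
        use_at T q c = Some U -> fu (nu (p, (q, c))) = U].

(** Injectivity of [t] and [nu], with uniqueness of canonical representatives, makes both inverse
    graphs single-valued; off their domains the identity is the default. *)
Lemma undoes_exists leT X C t nu : texpr_order leT ->
  injective t -> injective nu -> (forall q, VU (nu q) \notin X) ->
  exists ft fu, undoes leT X C t nu ft fu.
Proof.
move=> ord tI nuI nuX.
have [|ft [ftP ft_id]] := @functional_extension _ _
  (fun a b => exists p, a = t p /\ b = p.2) id.
  by move=> _ _ b' [p [-> ->]] [q [/tI-> ->]].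
have [|fu [fuP fu_id]] := @functional_extension _ _
  (fun r U => exists p q c T, [/\ r = nu (p, (q, c)),
     is_crep leT RCoh C (TVar p.2) T & use_at T q c = Some U]) UVar.
  move=> _ U U' [p [q [c [T [-> pT TU]]]]] [p' [q' [c' [T' [/nuI]]]]].
  move=> [<- <- <-] /(is_crep_inj ord pT)<-.
  by rewrite TU => -[].
exists ft, fu; split.
- by move=> p; apply: ftP; exists p.
- by move=> a at_; apply: ft_id => b [p [/at_]].
- move=> r rX; apply: fu_id => U [p [q [c [T [rE _ _]]]]].
  by have := nuX (p, (q, c)); rewrite -rE rX.
- by move=> p q c T U pT TU; apply: fuP; exists p, q, c, T.
Qed.

Lemma proj_sub ft fu S T :
  texpr_in_texpr S T -> texpr_in_texpr (proj ft fu S) (proj ft fu T).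
Proof.
elim: T => /= [a|| T IH U V|o T1 IH1 T2 IH2].
- by case=> // ->; left.
- by case=> // ->; left.
- by case=> [->|/IH]; [left|right].
- by case=> [->|[/IH1|/IH2]]; [left|right; left|right; right].
Qed.

Lemma proj_id leT X C t nu ft fu T : undoes leT X C t nu ft fu ->
  (forall p, VT (t p) \notin X) -> texpr_over X T -> proj ft fu T = T.
Proof.
move=> [_ ft_id fu_id _] tX.
have uid U : uexpr_over X U -> proj_uexpr fu U = U by case: U => //= r /fu_id.
elim: T => //= [a aX|T IH U V /and3P[/IH-> /uid-> /uid->]//|].
  by rewrite ft_id // => p aE; have := tX p; rewrite -aE aX.
by move=> o T1 IH1 T2 IH2 /andP[/IH1-> /IH2->].
Qed.

(** The supply [nu'] is arbitrary because [instance] shifts it at each binary constructor; the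
    hypothesis on [use_at] shifts along with it. *)
Lemma proj_instance leT X C t nu ft fu nu' a T :
  undoes leT X C t nu ft fu -> (forall p, VT (t p) \notin X) ->
  texpr_over X T ->
  (forall q c U, use_at T q c = Some U -> fu (nu' (q, c)) = U) ->
  proj ft fu (instance t nu' a T) = T.
Proof.
move=> und tX; elim: T nu' => //= [b|T IH U V|o T1 IH1 T2 IH2] nu' XT nu'P.
- by case: und => ->.
- rewrite (proj_id und tX); last by case/and3P: XT.
  by rewrite (nu'P [::] false U) ?(nu'P [::] true V).
- case/andP: XT => XT1 XT2; congr TBin.
    by apply: IH1 => // q c U; apply: (nu'P (false :: q)).
  by apply: IH2 => // q c U; apply: (nu'P (true :: q)).
Qed.

(** This is what the reflexivity rule needs when derivations are projected to [C]. *)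
Lemma texprs_completion leT X C t nu ft fu :
  generated X C -> (forall p, VT (t p) \notin X) ->
  undoes leT X C t nu ft fu ->
  forall T, texprs (completion leT t nu C) T -> texprs C (proj ft fu T).
Proof.
move=> XC tX und T [phi [phiC]].
case: phiC => {phi} [phi Cphi|a [Ca _]|a b T' phi phiC bphi bT'].
- move=> Tphi; have CT : texprs C T by exists phi.
  by rewrite (proj_id und tX) ?(generated_texprs XC CT).
- case=> -[] // -> /=; last by case: und => ->.
  by have [/= ->] := proj_id und tX (generated_texprs XC Ca).
- have [Cb CT'] := deduce_texprs bT'.1.
  case=> [[]//->/=|/(proj_sub ft fu)]; first by case: und => ->.
  rewrite (proj_instance _ und tX) ?(generated_texprs XC CT') //.
    exact: texprs_sub.
  by case: und => _ _ _ fuP q c U; apply: fuP.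
Qed.

(** The invariant for derivations from the completion. Of a combination it keeps only the two
    coherences given by (coh 2), which (cong 3) and (subst) preserve. *)
Definition proj_coherent C ft fu (phi : constr) : Prop :=
  match phi with
  | CEq T1 T2 | CCoh T1 T2 => deduce C (CCoh (proj ft fu T1) (proj ft fu T2))
  | CComb T1 T2 T3 => deduce C (CCoh (proj ft fu T1) (proj ft fu T2)) /\
                      deduce C (CCoh (proj ft fu T1) (proj ft fu T3))
  | CUse _ _ => True
  end.

Lemma proj_coherent_crel C ft fu R T1 T2 : proj_coherent C ft fu (crel R T1 T2) =
  deduce C (CCoh (proj ft fu T1) (proj ft fu T2)).
Proof. by case: R. Qed.

Lemma completion_coherent leT X C t nu ft fu phi :
  generated X C -> (forall p, VT (t p) \notin X) ->
  undoes leT X C t nu ft fu ->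
  completion leT t nu C phi -> proj_coherent C ft fu phi.
Proof.
move=> XC tX und; have idC T : texprs C T -> proj ft fu T = T.
  by move/(generated_texprs XC)/(proj_id und tX).
case=> {phi} [phi Cphi|a [Ca _]|a b T phi _ _ bT].
- case: phi Cphi => [T1 T2 C12|T1 T2 T3 C123|T1 T2 C12|//] /=.
  + have [CT1 CT2] := @texprs_crel REq _ _ _ C12.
    by rewrite !idC //; apply/d_coh1/d_axiom.
  + have [CT1 CT2 CT3] := texprs_comb C123.
    rewrite !idC //; split; first exact/d_coh2_l/d_axiom/C123.
    exact/d_coh2_r/d_axiom/C123.
  + have [CT1 CT2] := @texprs_crel RCoh _ _ _ C12.
    by rewrite !idC //; apply/d_axiom.
- have [aE] := idC _ Ca; rewrite /= aE.
  by case: und => -> _ _ _; apply: (@d_refl _ RCoh).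
- have [Cb CT] := deduce_texprs bT.1.
  rewrite /= (proj_instance _ und tX) ?(generated_texprs XC CT) //.
    by case: und => -> _ _ _; exact: bT.1.
  by case: und => _ _ _ fuP q c U; apply: fuP.
Qed.

(* Only coherence survives the projection: the equation a = t(a, a) becomes
   a ~ a, and t(a, b) = instance becomes b ~ crep b. This suffices because
   coherent channel types carry equal types. *)
Lemma deduce_coherent leT X C t nu ft fu phi :
  generated X C -> (forall p, VT (t p) \notin X) ->
  undoes leT X C t nu ft fu ->
  deduce (completion leT t nu C) phi -> proj_coherent C ft fu phi.
Proof.
move=> XC tX und.
have symC T S : deduce C (CCoh T S) -> deduce C (CCoh S T).
  by move/(@d_symm _ RCoh).
have transC T S R : deduce C (CCoh T S) -> deduce C (CCoh S R) ->
    deduce C (CCoh T R) by move=> *; apply: (@d_trans _ RCoh); eassumption.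
elim=> {phi}.
- by move=> phi; apply: completion_coherent und.
- move=> R T CT; rewrite proj_coherent_crel.
  by apply: (@d_refl _ RCoh); apply: (texprs_completion XC tX und).
- by move=> R T S _; rewrite !proj_coherent_crel; apply: symC.
- by move=> R T1 T2 T3 _ + _; rewrite !proj_coherent_crel; apply: transC.
- by [].
- by move=> T S1 S2 _ [].
- by move=> T S1 S2 _ [].
- by move=> T S U1 U2 V1 V2 _ /= /d_cong1/d_coh1.
- by move=> R o T1 T2 S1 S2 _; rewrite !proj_coherent_crel => /(@d_cong2_l _ RCoh).
- by move=> R o T1 T2 S1 S2 _; rewrite !proj_coherent_crel => /(@d_cong2_r _ RCoh).
- by move=> o T1 T2 S1 S2 S3 S4 _ /= [/(@d_cong2_l _ RCoh) ? /(@d_cong2_l _ RCoh)].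
- by move=> o T1 T2 S1 S2 S3 S4 _ /= [/(@d_cong2_r _ RCoh) ? /(@d_cong2_r _ RCoh)].
- move=> T1 T2 T3 S1 S2 S3 _ [T12 T13] _ /= /symC ST1 _ TS2 _ TS3.
  by split; apply: (transC _ _ _ ST1); [apply: transC TS2|apply: transC TS3].
- by [].
- by [].
- by [].
- by [].
Qed.

Lemma topcon_proj ft fu T : topcon (proj ft fu T) = topcon T.
Proof. by case: T. Qed.

Lemma proj_proper ft fu T : tproper T -> tproper (proj ft fu T).
Proof. by case: T => // a /(_ a). Qed.

Lemma completion_consistent leT X C t nu :
  texpr_order leT -> generated X C ->
  injective t -> (forall p, VT (t p) \notin X) ->
  injective nu -> (forall q, VU (nu q) \notin X) ->
  (forall T S, deduce C (CCoh T S) -> tproper T -> tproper S ->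
     topcon T = topcon S) ->
  forall T S, deduce (completion leT t nu C) (CCoh T S) ->
    tproper T -> tproper S -> topcon T = topcon S.
Proof.
move=> ord XC tI tX nuI nuX consC T S TS Tprop Sprop.
have [ft [fu und]] := undoes_exists C ord tI nuI nuX.
rewrite -(topcon_proj ft fu T) -(topcon_proj ft fu S).
by apply: consC; [exact: (deduce_coherent XC tX und TS)|apply: proj_proper..].
Qed.

Lemma instance_proper t nu a T : tproper T -> tproper (instance t nu a T).
Proof. by case: T => // b /(_ b). Qed.

Lemma completion_proper leT X C t nu a :
  texpr_order leT -> generated X C ->
  injective t -> (forall p, VT (t p) \notin X) ->
  injective nu -> (forall q, VU (nu q) \notin X) ->
  undef leT RCoh C = set0 ->
  texprs (completion leT t nu C) (TVar a) ->
  exists2 T, tproper T & deduce (completion leT t nu C) (CEq (TVar a) T).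
Proof.
move=> ord XC tI tX nuI nuX undefC aC.
have [ft [fu und]] := undoes_exists C ord tI nuI nuX.
have fa := texprs_completion XC tX und aC.
have crep b : texprs C (TVar b) ->
    exists2 T, is_crep leT RCoh C (TVar b) T & tproper T.
  move=> Cb; have [T bT] := is_crep_exists RCoh ord XC.1 Cb.
  exists T => //; apply: contrapT => Tvar.
  by have : undef leT RCoh C b by [split=> //; exists T]; rewrite undefC.
have [[p aE]|at_] := pselect (exists p, a = t p).
  move: fa; rewrite aE /=; have [-> _ _ _] := und.
  move=> /crep[T pT Tprop]; exists (instance t (fun q => nu (p, q)) p.1 T).
    exact: instance_proper.
  (* The constraint in which [a] occurs is the one that triggers its instantiation. *)
  case: aC => phi [phiC aphi]; apply: d_axiom.
  case: p aE pT => b c aE pT; apply: compl_instance pT; first exact: phiC.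
  by rewrite -aE.
have {fa}Ca : texprs C (TVar a).
  move: fa => /=; have [_ -> //] := und.
  by move=> p ap; apply: at_; exists p.
have [T aT] := is_crep_exists REq ord XC.1 Ca.
have [Tprop|Tvar] := pselect (tproper T).
  by exists T => //; apply: deduce_mono aT.1; apply: compl_base.
(* Here [a] has no proper representative for equality, so it is linked to [t (a, a)]; this very
   constraint then triggers the instantiation of [t (a, a)]. *)
have loop : completion leT t nu C (CEq (TVar a) (TVar (t (a, a)))).
  by apply: compl_undef; split=> //; exists T.
have [S aS Sprop] := crep _ Ca.
exists (instance t (fun q => nu ((a, a), q)) a S); first exact: instance_proper.
apply: (@d_trans _ REq _ (TVar (t (a, a)))); first exact: d_axiom.
by apply: d_axiom; apply: compl_instance loop _ aS; right; left.
Qed.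

(** * Solving the completion *)

Lemma apply_use_total C s U :
  (forall r, uexprs C (UVar r) -> r \in domf s) ->
  (forall V, uexpr_in_uexpr V U -> uexprs C V) ->
  exists k, apply_use s U = Some k.
Proof.
move=> domC; elim: U => /= [r|k|U1 IH1 U2 IH2] CU.
- by rewrite in_fnd ?domC //; [apply: CU; left | eexists].
- by exists k.
- have [|k1 ->] := IH1; first by move=> V V1; apply: CU; right; left.
  have [|k2 ->] := IH2; first by move=> V V2; apply: CU; right; right.
  by exists (use_add k1 k2).
Qed.

Lemma apply_total C s T :
  (forall a, texprs C (TVar a) -> a \in domf (subst_type s)) ->
  (forall r, uexprs C (UVar r) -> r \in domf (subst_use s)) ->
  texprs C T -> exists x, apply s T = Some x.
Proof.
move=> domT domU; elim: T => /= [a|| T IH U V|o T1 IH1 T2 IH2] CT.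
- by rewrite in_fnd ?domT //; eexists.
- by exists Int.
- have [x ->] := IH (texprs_chan CT).
  have [|k1 ->] := apply_use_total (U := U) domU.
    by move=> W WU; apply: (uexprs_sub CT); apply: Or32.
  have [|k2 ->] := apply_use_total (U := V) domU.
    by move=> W WV; apply: (uexprs_sub CT); apply: Or33.
  by eexists.
- have [x1 ->] := IH1 (texprs_binl CT).
  have [x2 ->] := IH2 (texprs_binr CT).
  by eexists.
Qed.

(** A use variable outside [su] is undefined on both sides. The equations of the system can thus be
    read under the combined substitution. *)
Lemma apply_usubst st su T :
  apply (Subst st [fmap]%fmap) (usubst_texpr su T) = apply (Subst st su) T.
Proof.
have applyU U : apply_use [fmap]%fmap (usubst_uexpr su U) = apply_use su U.
  elim: U => /= [r|//|U1 -> U2 ->//].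
  by case E : (fnd su r) => [k|] //=; rewrite fnd_fmap0.
by elim: T => //= [T -> U V|o T1 -> T2 ->//]; rewrite !applyU.
Qed.

(** With the deduction rules, these four facts are all that the coinductive arguments use of the
    completion and its solution. *)
Definition well_defined C (s : subst) : Prop :=
  [/\ forall T S, deduce C (CCoh T S) -> tproper T -> tproper S ->
        topcon T = topcon S,
      forall T, texprs C T -> exists x, apply s T = Some x,
      forall a, texprs C (TVar a) -> exists T,
        [/\ tproper T, deduce C (CEq (TVar a) T) & satisfies s (CEq (TVar a) T)]
    & forall U V, deduce C (CUse U V) -> satisfies s (CUse U V)].

Lemma proper_repr C s T x : well_defined C s -> texprs C T ->
  apply s T = Some x -> exists S y,
  [/\ tproper S, deduce C (CEq T S), apply s S = Some y & teq x y].
Proof.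
move=> [_ _ repr _] CT Tx.
have [Tprop|nTprop] := pselect (tproper T).
  exists T, x; split=> //; first exact: (@d_refl _ REq).
  exact: teq_refl.
case: T => [a||T U V|o T1 T2] in CT Tx nTprop *; try by case: nTprop.
have [S [Sprop aS [y [z [ay Sz yz]]]]] := repr _ CT.
by exists S, z; split=> //; move: ay; rewrite Tx => -[->].
Qed.

Lemma apply_binE s o T1 T2 x : apply s (TBin o T1 T2) = Some x ->
  exists x1 x2, [/\ apply s T1 = Some x1, apply s T2 = Some x2 & x = Bin o x1 x2].
Proof.
move=> /=; case: (apply s T1) => // x1; case: (apply s T2) => // x2 [<-].
by exists x1, x2.
Qed.

Lemma apply_chanE s T U V x : apply s (TChan T U V) = Some x ->
  exists y k1 k2, [/\ apply s T = Some y, apply_use (subst_use s) U = Some k1,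
    apply_use (subst_use s) V = Some k2 & x = Chan y k1 k2].
Proof.
move=> /=; case: (apply s T) => // y; case: (apply_use _ U) => // k1.
by case: (apply_use _ V) => // k2 [<-]; exists y, k1, k2.
Qed.

(** The candidate bisimulation. Closure under [teq] is built in because a variable and its proper
    representative denote trees that are merely bisimilar. *)
Definition deduced_eq C s (x y : tree) : Prop := exists T S x' y',
  [/\ deduce C (CEq T S), apply s T = Some x', apply s S = Some y',
      teq x x' & teq y y'].

Lemma deduced_eq_teq C s : well_defined C s ->
  forall x y, deduced_eq C s x y -> teq x y.
Proof.
move=> wd; apply: teq_coind => x y [T [S [x' [y' [TS Tx Sy xx' yy']]]]].
have [CT CS] := deduce_texprs TS.
have [T' [x2 [T'p TT' T'x x'x2]]] := proper_repr wd CT Tx.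
have [S' [y2 [S'p SS' S'y y'y2]]] := proper_repr wd CS Sy.
have T'S' : deduce C (CEq T' S').
  apply: (@d_trans _ REq _ S) SS'.
  exact: (@d_trans _ REq _ T) (@d_symm _ REq _ _ TT') TS.
(* The comparison moves to the values of the proper representatives, whose roots are visible. *)
apply: (@teq_step_teq _ x x2 y y2); [|exact: teq_trans x'x2|exact: teq_trans y'y2|].
  move=> r r' q q' rr' qq' [T0 [S0 [r0 [q0 [? ? ? r'r0 q'q0]]]]].
  exists T0, S0, r0, q0; split=> //; first exact: teq_trans r'r0.
  exact: teq_trans q'q0.
have sub T0 S0 x0 y0 : deduce C (CEq T0 S0) -> apply s T0 = Some x0 ->
    apply s S0 = Some y0 -> deduced_eq C s x0 y0.
  by move=> *; exists T0, S0, x0, y0; split=> //; apply: teq_refl.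
have [cons _ _ uses] := wd.
have /= := cons _ _ (d_coh1 T'S') T'p S'p.
case: T' => [a||T1 U1 V1|o T1 T2] in T'p T'S' T'x {TT'} *; first by case: (T'p a).
all: case: S' => [b||S1 U2 V2|o' S1 S2] in S'p T'S' S'y {SS'} * => //.
- by move: T'x S'y => [<-] [<-]; constructor.
- move=> _; have [x3 [k1 [k2 [Tx3 U1k V1k ->]]]] := apply_chanE T'x.
  have [y3 [k3 [k4 [Sy3 U2k V2k ->]]]] := apply_chanE S'y.
  have [k [U1k' U2k']] := uses _ _ (d_use1_l T'S').
  have [l [V1l V2l]] := uses _ _ (d_use1_r T'S').
  move: U1k U2k V1k V2k; rewrite U1k' U2k' V1l V2l => -[<-] [<-] [<-] [<-].
  (* The equation is weakened to a coherence because (cong 1) starts from one, yet it still yields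
     equal payloads. *)
  by constructor; apply: sub Tx3 Sy3; apply: d_cong1 (d_coh1 T'S').
- case=> oo'; rewrite -{o'}oo' in T'S' S'y S'p *.
  have [x3 [x4 [Tx3 Tx4 ->]]] := apply_binE T'x.
  have [y3 [y4 [Sy3 Sy4 ->]]] := apply_binE S'y.
  constructor; first by apply: sub Tx3 Sy3; apply: (@d_cong2_l _ REq) T'S'.
  by apply: sub Tx4 Sy4; apply: (@d_cong2_r _ REq) T'S'.
Qed.

Lemma deduce_eq_satisfies C s T S : well_defined C s ->
  deduce C (CEq T S) -> satisfies s (CEq T S).
Proof.
move=> wd TS; have [_ total _ _] := wd.
have [/total[x Tx] /total[y Sy]] := deduce_texprs TS.
exists x, y; split=> //; apply: (deduced_eq_teq wd).
by exists T, S, x, y; split=> //; apply: teq_refl.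
Qed.

(** The result of the combination is first in [CComb] and last in [tcomb]. *)
Definition deduced_comb C s (x y z : tree) : Prop := exists T T1 T2 x' y' z',
  [/\ deduce C (CComb T T1 T2), apply s T1 = Some x', apply s T2 = Some y',
      apply s T = Some z' & [/\ teq x x', teq y y' & teq z z']].

Lemma deduced_comb_tcomb C s : well_defined C s ->
  forall x y z, deduced_comb C s x y z -> tcomb x y z.
Proof.
move=> wd; apply: tcomb_coind => x y z.
move=> [T [T1 [T2 [x' [y' [z' [TT Tx Ty Tz [xx' yy' zz']]]]]]]].
have [CT CT1 CT2] := deduce_texprs TT.
have [R [z2 [Rp TR Rz z'z2]]] := proper_repr wd CT Tz.
have [R1 [x2 [R1p TR1 Rx x'x2]]] := proper_repr wd CT1 Tx.
have [R2 [y2 [R2p TR2 Ry y'y2]]] := proper_repr wd CT2 Ty.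
(* Rule (subst) makes all three expressions proper at once; (coh 2) then forces a common topmost
   constructor. *)
have {TR TR1 TR2}RR : deduce C (CComb R R1 R2) by apply: d_subst TR TR1 TR2.
apply: (@tcomb_step_teq _ x x2 y y2 z z2);
  [|exact: teq_trans x'x2|exact: teq_trans y'y2|exact: teq_trans z'z2|].
  move=> a a' b b' c c' aa' bb' cc'.
  move=> [T0 [T01 [T02 [a0 [b0 [c0 [? ? ? ? [a0E b0E c0E]]]]]]]].
  exists T0, T01, T02, a0, b0, c0; split=> //.
  by split; [apply: teq_trans a0E|apply: teq_trans b0E|apply: teq_trans c0E].
have sub S S1 S2 a b c : deduce C (CComb S S1 S2) -> apply s S1 = Some a ->
    apply s S2 = Some b -> apply s S = Some c -> deduced_comb C s a b c.
  move=> *; exists S, S1, S2, a, b, c; split=> //.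
  by split; apply: teq_refl.
have [cons _ _ uses] := wd.
have /= con1 := cons _ _ (d_coh2_l RR) Rp R1p.
have /= con2 := cons _ _ (d_coh2_r RR) Rp R2p.
case: R => [a||S U V|o S1 S2] in Rp RR Rz con1 con2; first by case: (Rp a).
- case: R1 => // in Rx R1p RR con1; case: R2 => // in Ry R2p RR con2.
  by move: Rx Ry Rz => [<-] [<-] [<-]; constructor.
- case: R1 => // S1 U1 V1 in Rx R1p RR con1.
  case: R2 => // S2 U2 V2 in Ry R2p RR con2.
  have [z3 [k1 [k2 [Sz Uk Vk ->]]]] := apply_chanE Rz.
  have [x3 [k3 [k4 [Sx U1k V1k ->]]]] := apply_chanE Rx.
  have [y3 [k5 [k6 [Sy U2k V2k ->]]]] := apply_chanE Ry.
  have [k [Uk' /= Ukk]] := uses _ _ (d_use2_l RR).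
  have [l [Vl /= Vll]] := uses _ _ (d_use2_r RR).
  move: Ukk Vll; rewrite U1k U2k V1k V2k => -[kE] [lE].
  move: Uk Vk; rewrite Uk' Vl => -[<-] [<-]; rewrite -kE -lE.
  (* Both operands are coherent with the result, so their payloads are deducibly equal to its
     payload, and the equational case gives bisimilarity. *)
  constructor.
    have [a [b [aE bE ab]]] := deduce_eq_satisfies wd (d_cong1 (d_coh2_l RR)).
    move: aE bE ab; rewrite Sz Sx => -[<-] [<-]; exact: teq_sym.
  have [a [b [aE bE ab]]] := deduce_eq_satisfies wd (d_cong1 (d_coh2_r RR)).
  move: aE bE ab; rewrite Sz Sy => -[<-] [<-]; exact: teq_sym.
- case: R1 => // o1 S11 S12 in Rx R1p RR con1.
  case: R2 => // o2 S21 S22 in Ry R2p RR con2.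
  case: con1 con2 => oo1 [oo2]; rewrite -{}oo1 -{}oo2 in Rx Ry RR.
  have [z3 [z4 [Sz3 Sz4 ->]]] := apply_binE Rz.
  have [x3 [x4 [Sx3 Sx4 ->]]] := apply_binE Rx.
  have [y3 [y4 [Sy3 Sy4 ->]]] := apply_binE Ry.
  constructor; first by apply: sub Sx3 Sy3 Sz3; apply: d_cong3_l RR.
  by apply: sub Sx4 Sy4 Sz4; apply: d_cong3_r RR.
Qed.

Lemma deduce_comb_satisfies C s T S1 S2 : well_defined C s ->
  deduce C (CComb T S1 S2) -> satisfies s (CComb T S1 S2).
Proof.
move=> wd TS; have [_ total _ _] := wd.
have [/total[z Tz] /total[x Sx] /total[y Sy]] := deduce_texprs TS.
exists z, x, y; split=> //; apply: (deduced_comb_tcomb wd).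
exists T, S1, S2, x, y, z; split=> //; split; exact: teq_refl.
Qed.

Theorem theorem5p12
  (leT : rel texpr)
  (t : tvar * tvar -> tvar)
  (nu : (tvar * tvar) * (seq bool * bool) -> uvar)
  (P : proc) (D : env) (C : set constr) (X : {fset var})
  (s_use : usubst) (s_type : tsubst) :
  texpr_order leT ->
  pgen P D C X ->
  injective t -> (forall p, VT (t p) \notin X) ->
  injective nu -> (forall q, VU (nu q) \notin X) ->
  undef leT RCoh C = set0 ->
  (forall T S : texpr, deduce C (CCoh T S) -> tproper T -> tproper S ->
     topcon T = topcon S) ->
  use_solution (completion leT t nu C) s_use ->
  system_solution leT (completion leT t nu C) s_use s_type ->
  solution (Subst s_type s_use) C.
Proof.
move=> ord /pgen_generated[_ XC] tI tX nuI nuX undefC consC [domU useP].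
move=> [domT typeP]; set s := Subst s_type s_use.
have subC : C `<=` completion leT t nu C by apply: compl_base.
have wd : well_defined (completion leT t nu C) s.
  split.
  - exact: (completion_consistent ord XC).
  - by move=> T; apply: apply_total => [a /domT|r /domU].
  - move=> a aC.
    have [S Sprop aS] := completion_proper ord XC tI tX nuI nuX undefC aC.
    (* The system gives an equation only for the canonical representative [T]; the proper [S] serves
       to show that [T] is proper. *)
    have [T aT] := is_crep_exists REq ord (finite_completion leT nu XC tI tX) aC.
    exists T; split; [exact: crep_proper aT|exact: aT.1|].
    have [x [y [ax Ty xy]]] := typeP _ _ aC aT.
    by exists x, y; split=> //; rewrite -apply_usubst.
  - exact: useP.
split=> [a|r|phi Cphi]; first by move/(texprs_mono subC)/domT.
  by move/(uexprs_mono subC)/domU.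
(* Generated constraints are equations and combinations only, so two cases remain. *)
move: (XC.2 _ Cphi) (d_axiom (subC _ Cphi)).
case: phi {Cphi} => // [T S|T S1 S2] _.
  exact: deduce_eq_satisfies.
exact: deduce_comb_satisfies.
Qed.
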